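(* Let $\dot{\mathfrak g}$ be the simple complex Lie algebra of type $X_\ell$ ($X_\ell$ one of $A_\ell,B_\ell,C_\ell,D_\ell,E_\ell,F_4,G_2$), and let $\sigma_0=\sigma_1=\mathrm{id}$. Then the set $R$ of non-isotropic roots of the 2-toroidal Lie algebra $\mathfrak g(\sigma_0,\sigma_1)$ is the extended affine root system $X_\ell^{(1,1)}$: $$R=\{\alpha+m\delta_0+n\delta_1\mid \alpha\in R(X_\ell),\ m,n\in\mathbb Z\},$$ where $R(X_\ell)$ is the root system of $\dot{\mathfrak g}$ with respect to the chosen Cartan subalgebra.
   Context: Work over $\mathbb C$. Let $\dot{\mathfrak g}$ be a simple finite-dimensional Lie algebra with Killing form $(\cdot,\cdot)$, and $\sigma_0,\sigma_1$ commuting automorphisms of finite orders $n_0,n_1$ (order 1 allowed). Put $\epsilon_j=\exp(2\pi i/n_j)$ and, for $p,q\in\mathbb Z$, $\dot{\mathfrak g}_{(\overline p,\overline q)}=\{g\in\dot{\mathfrak g}\mid\sigma_0(g)=\epsilon_0^p g,\ \sigma_1(g)=\epsilon_1^q g\}$, where $\overline p=p \bmod n_0$, $\overline q=q\bmod n_1$. Let $\mathcal R=\mathbb C[t_0^{\pm1},t_1^{\pm1}]$, $\mathcal K=\Omega^1_{\mathcal R}/d\mathcal R$, $k_i=t_i^{-1}dt_i$, and let $\mathcal K(\Sigma)\subset\mathcal K$ be spanned by the elements $t_0^{n_0a}t_1^{n_1b}k_i$ ($a,b\in\mathbb Z$, $i=0,1$). The twisted 2-toroidal Lie algebra is $$\mathfrak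 g(\sigma_0,\sigma_1)=\bigoplus_{m,n\in\mathbb Z}\dot{\mathfrak g}_{(\overline m,\overline n)}\otimes t_0^mt_1^n\ \oplus\ \mathcal K(\Sigma)\ \oplus\ \mathbb Cd_0\oplus\mathbb Cd_1,$$ with bracket $[g_1\otimes f_1,g_2\otimes f_2]=[g_1,g_2]\otimes f_1f_2+(g_1,g_2)f_2\,df_1$; $\mathcal K(\Sigma)$ commutes with itself and with all $g\otimes f$; $d_j=t_j\partial/\partial t_j$ acts by $[d_j,g\otimes t_0^{r_0}t_1^{r_1}]=r_j\,g\otimes t_0^{r_0}t_1^{r_1}$, $[d_j,t_0^{r_0}t_1^{r_1}k_i]=r_j\,t_0^{r_0}t_1^{r_1}k_i$; and $[d_0,d_1]=0$. Let $\dot{\mathfrak h}_{\overline 0}$ be a Cartan subalgebra of the reductive algebra $\dot{\mathfrak g}_{(\overline 0,\overline 0)}$ and $\mathfrak h=\dot{\mathfrak h}_{\overline 0}\oplus\mathbb Cd_0\oplus\mathbb Cd_1\oplus\mathbb Ck_0\oplus\mathbb Ck_1$. Elements of $\dot{\mathfrak h}_{\overline 0}^*$ are extended to $\mathfrak h$ by $0$ on all $d_i,k_i$; $\delta_i\in\mathfrak h^*$ is defined by $\delta_i(d_j)=\delta_{ij}$ and zero on $\dot{\mathfrak h}_{\overline 0}$ and all $k_j$. Let $V=\dot{\mathfrak h}_{\overline 0}^*\oplus\mathbb C\delta_0\oplus\mathbb C\delta_1$ with the bilinear form $(\cdot,\cdot)_V$ which on $\dot{\mathfrak h}_{\overline 0}^*$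 is dual to the restriction of the Killing form to $\dot{\mathfrak h}_{\overline 0}$ and has $\delta_0,\delta_1$ in its radical. Then $R$ is the set of $\beta\in V$ with $(\beta,\beta)_V\ne0$ whose weight space in $\mathfrak g(\sigma_0,\sigma_1)$ under the adjoint action of $\mathfrak h$ is nonzero. *)

(* Defs.v *)
From HB Require Import structures.
From mathcomp Require Import all_boot all_order all_algebra.
From mathcomp Require Import finmap.
From mathcomp Require Import generic_quotient ring_quotient complex.
From mathcomp Require Import all_classical all_reals all_analysis.

Set Implicit Arguments.
Unset Strict Implicit.
Unset Printing Implicit Defensive.

Import Order.TTheory GRing.Theory Num.Theory.
Local Open Scope ring_scope.
Local Open Scope classical_set_scope.

HB.mixin Record isLieAlgebra (F : fieldType) L of GRing.Lmodule F L := {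
  lie : L -> L -> L;
  lie_linearl : forall y, linear (lie^~ y);
  lie_linearr : forall x, linear (lie x);
  liexx : forall x, lie x x = 0;
  lie_jacobi : forall x y z,
    lie x (lie y z) + lie y (lie z x) + lie z (lie x y) = 0 }.

#[short(type="lieAlgType")]
HB.structure Definition LieAlgebra (F : fieldType) :=
  {L of isLieAlgebra F L & GRing.Lmodule F L}.

#[short(type="finLieAlgType")]
HB.structure Definition FinLieAlgebra (F : fieldType) :=
  {L of isLieAlgebra F L & Vector F L}.

Section LieTheory.
Variables (F : fieldType) (L : lieAlgType F).
Implicit Types x y z : L.

HB.instance Definition _ x :=
  GRing.isLinear.Build F L L *:%R (lie x) (lie_linearr x).

Lemma lieDl x y z : lie (x + y) z = lie x z + lie y z.
Proof. by have := lie_linearl z 1 x y; rewrite !scale1r. Qed.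
Lemma lie0l z : lie 0 z = 0.
Proof. by apply: (addrI (lie 0 z)); rewrite -lieDl !addr0. Qed.
Lemma lieZl a y z : lie (a *: y) z = a *: lie y z.
Proof. by have := lie_linearl z a y 0; rewrite !addr0 lie0l addr0. Qed.
Lemma lieC x y : lie x y = - lie y x.
Proof.
apply/eqP; rewrite -addr_eq0; apply/eqP.
by have := liexx (x + y); rewrite lieDl !linearD /= !liexx add0r addr0.
Qed.
End LieTheory.

Section FinDim.
Variables (F : fieldType) (g : finLieAlgType F).
Implicit Types (U V A H I : {vspace g}) (x y : g).

Definition endo_trace (f : g -> g) : F :=
  \sum_i coord (vbasis {:g}) i (f (vbasis {:g})`_i).

Definition killing x y : F := endo_trace (lie x \o lie y).

Definition simple_lie :=
  (exists x y, lie x y != 0) /\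
  forall I, (forall x y, y \in I -> lie x y \in I) -> I = 0%VS \/ I = {:g}%VS.

(* The span of all brackets of an element of U and an element of V: by
   bilinearity it is enough to take brackets of basis vectors. *)
Definition lie_prodv U V : {vspace g} :=
  <<[seq lie x y | x <- vbasis U, y <- vbasis V]>>%VS.

Definition nilpotent_lie H := exists k, iter k (lie_prodv H) H = 0%VS.

(* H is a nilpotent subalgebra of A that is its own normaliser in A. *)
Definition cartan_subalgebra A H :=
  [/\ (H <= A)%VS, {in H &, forall x y, lie x y \in H}, nilpotent_lie H &
      forall x, x \in A -> {in H, forall h, lie x h \in H} -> x \in H].

Section Dual.
Variable H : {vspace g}.

Local Notation dual := 'Hom(subvs_of H, F^o).

Definition killing_flat : 'Hom(subvs_of H, dual) :=
  linfun (fun x : subvs_of H =>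
    linfun (fun y : subvs_of H => killing (vsval x) (vsval y) : F^o)).

(* The form on the dual of H obtained by transporting the restriction of the
   Killing form along x |-> (x, -); [^-1] is the inverse of this map when the
   restriction is nondegenerate. *)
Definition dual_killing (a b : dual) : F :=
  killing (vsval ((killing_flat^-1)%VF a)) (vsval ((killing_flat^-1)%VF b)).

Definition root_system : set dual :=
  [set a | a != 0 /\ exists2 x : g, x != 0 &
     forall h : subvs_of H, lie (vsval h) x = a h *: x].

End Dual.
End FinDim.

Arguments root_system {F g} H _.

(* The exponent r of the monomial t^r = t_0^(r_0) t_1^(r_1). *)
Notation degree := 'rV[int]_2.

Section Loop.
Variables (F : fieldType) (V : lmodType F).

Definition fin_supp : {pred degree -> V} :=
  fun u => `[< finite_set [set r | u r != 0] >].

Lemma fin_supp_submod : submod_closed fin_supp.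
Proof.
split=> [|a u v /asboolP fu /asboolP fv]; apply/asboolP.
  apply: (sub_finite_set _ (finite_set0 degree)) => r /=.
  by case/eqP.
have fuv : finite_set ([set r | u r != 0] `|` [set r | v r != 0]).
  by rewrite finite_setU.
apply: (sub_finite_set _ fuv) => r /=.
case: (eqVneq (u r) 0) => [u0|]; last by left.
case: (eqVneq (v r) 0) => [v0|]; last by right.
have -> : (a *: u + v) r = a *: u r + v r by [].
by rewrite u0 v0 scaler0 addr0 eqxx.
Qed.
HB.instance Definition _ :=
  GRing.isSubmodClosed.Build F (degree -> V) fin_supp fin_supp_submod.

(* Finitely supported families (x_r), standing for the sum of the x_r (x) t^r
   in V (x) C[t_0^+-1, t_1^+-1]. *)
Record loop := Loop { coeff :> degree -> V ; _ : coeff \in fin_supp }.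
HB.instance Definition _ := [isSub for coeff].
HB.instance Definition _ := [Choice of loop by <:].
HB.instance Definition _ := [SubChoice_isSubLmodule of loop by <:].

Lemma mono_fin_supp r (x : V) : (fun s => if s == r then x else 0) \in fin_supp.
Proof.
apply/asboolP; apply: (sub_finite_set _ (finite_set1 r)) => s /=.
by case: ifP => [/eqP|_ /eqP].
Qed.
Definition mono r (x : V) : loop := Loop (mono_fin_supp r x).

#[local] Arguments coeff : simpl never.

Lemma monoE r x s : mono r x s = if s == r then x else 0.
Proof. by []. Qed.
Lemma coeffD (u v : loop) r : (u + v) r = u r + v r. Proof. by []. Qed.
Lemma coeffZ a (u : loop) r : (a *: u) r = a *: u r. Proof. by []. Qed.
Lemma coeff0 r : (0 : loop) r = 0. Proof. by []. Qed.
Lemma loopP (u v : loop) : (forall r, u r = v r) -> u = v.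
Proof. by move=> uv; apply: val_inj; apply/funext. Qed.

Lemma mono_linear r : linear (mono r).
Proof.
move=> a x y; apply: loopP => s; rewrite coeffD coeffZ !monoE.
by case: eqP => _ //; rewrite scaler0 addr0.
Qed.
HB.instance Definition _ r :=
  GRing.isLinear.Build F V loop *:%R (mono r) (mono_linear r).

Lemma loop_finite (u : loop) : finite_set [set r | u r != 0].
Proof. by apply/asboolP; exact: (valP u). Qed.

End Loop.

#[global] Arguments coeff {F V} _ _ : simpl never.

Lemma linear_at0 (F : fieldType) (V W : lmodType F) (h : V -> W) : linear h -> h 0 = 0.
Proof.
by move=> hl; have := hl (-1) 0 0; rewrite scaler0 addr0 scaleN1r addNr.
Qed.

Section Ext.
Variables (F : fieldType) (V W : lmodType F).

(* The linear extension to [loop V] of the maps x (x) t^r |-> f r x. *)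
Definition ext (f : degree -> V -> W) (u : loop V) : W :=
  \sum_(r \in [set r | u r != 0]) f r (u r).

Lemma ext_seq (f : degree -> V -> W) (u : loop V) (s : seq degree) :
  (forall r, f r 0 = 0) -> uniq s -> (forall r, u r != 0 -> r \in s) ->
  ext f u = \sum_(r <- s) f r (u r).
Proof.
move=> f0 us su; rewrite (fsbig_seq _ _ us) /ext; apply: fsbig_widen => //.
by move=> r /= [_ /negP]; rewrite negbK => /eqP ->.
Qed.

Definition supp2 (u v : loop V) : seq degree :=
  undup (enum_fset (fset_set [set r | u r != 0]) ++
         enum_fset (fset_set [set r | v r != 0])).

Lemma extE (f : degree -> V -> W) (u : loop V) :
  ext f u = \sum_(r <- fset_set [set r | u r != 0]) f r (u r).
Proof. by rewrite /ext fsbig_finite //; exact: loop_finite. Qed.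

Lemma ext_linear (f : degree -> V -> W) :
  (forall r, linear (f r)) -> linear (ext f).
Proof.
move=> fl; have f0 r : f r 0 = 0 by exact: linear_at0.
move=> a u v; set s := supp2 u v.
have us : uniq s by exact: undup_uniq.
have su r : u r != 0 -> r \in s.
  by move=> ur; rewrite mem_undup mem_cat in_fset_set ?mem_set//; exact: loop_finite.
have sv r : v r != 0 -> r \in s.
  move=> vr; rewrite mem_undup mem_cat orbC in_fset_set ?mem_set//.
  exact: loop_finite.
rewrite !(ext_seq _ us) // => [|r].
  rewrite scaler_sumr -big_split /=; apply: eq_bigr => r _.
  by rewrite coeffD coeffZ fl.
apply: contraNT => rs; rewrite coeffD coeffZ.
have /eqP -> : u r == 0 by apply: contraNT rs => /su.
have /eqP -> : v r == 0 by apply: contraNT rs => /sv.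
by rewrite scaler0 addr0.
Qed.

Lemma ext_mono (f : degree -> V -> W) r x :
  (forall r, linear (f r)) -> ext f (mono r x) = f r x.
Proof.
move=> fl.
rewrite (@ext_seq _ _ [:: r]) => [|s|//|s]; last rewrite monoE.
- by rewrite big_seq1 monoE eqxx.
- exact: linear_at0.
- by rewrite inE; case: (s == r) => //; rewrite eqxx.
Qed.

Lemma loop_sum (u : loop V) :
  u = \sum_(r <- fset_set [set r | u r != 0]) mono r (u r).
Proof.
apply: loopP => s.
have cs (t : seq degree) :
    (\sum_(r <- t) mono r (u r)) s = \sum_(r <- t) mono r (u r) s.
  by elim: t => [|r t IH]; rewrite ?big_nil// !big_cons coeffD IH.
rewrite cs; have [us|us] := eqVneq (u s) 0.
  rewrite us big1 // => r _; rewrite monoE; by case: eqP => // <-.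
rewrite (bigD1_seq s) /= ?fset_uniq ?in_fset_set ?mem_set//; last exact: loop_finite.
rewrite monoE eqxx big1 ?addr0 // => r /negPf; rewrite eq_sym => rs.
by rewrite monoE rs.
Qed.

Lemma loop_ind (P : loop V -> Prop) : P 0 ->
  (forall u v, P u -> P v -> P (u + v)) -> (forall r x, P (mono r x)) ->
  forall u, P u.
Proof.
move=> P0 PD Pm u; rewrite [u]loop_sum.
by elim/big_ind: _ => // r _; exact: Pm.
Qed.

Lemma loop_ext0 (f : loop V -> W) : linear f ->
  (forall r x, f (mono r x) = 0) -> forall u, f u = 0.
Proof.
move=> fl fm; apply: loop_ind => [|u v fu fv|//]; first exact: linear_at0.
by have := fl 1 u v; rewrite !scale1r fu fv addr0.
Qed.

Lemma ext_linear_fun (k : F) (f h e : degree -> V -> W) u :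
  (forall r x, e r x = k *: f r x + h r x) ->
  ext e u = k *: ext f u + ext h u.
Proof.
move=> efh; rewrite !extE scaler_sumr -big_split.
by apply: eq_bigr => r _; rewrite efh.
Qed.
End Ext.

Section Kahler.
Variable F : fieldType.

Definition intdeg (r : degree) : 'rV[F]_2 := map_mx intr r.

(* The Kaehler differentials of the Laurent polynomials form the free module
   on k_0 = t_0^-1 dt_0 and k_1 = t_1^-1 dt_1; [mono r a] is
   t^r (a_0 k_0 + a_1 k_1), and d(t^r) = t^r (r_0 k_0 + r_1 k_1). *)
Definition omega1 := loop ('rV[F]_2 : lmodType F).
HB.instance Definition _ := GRing.Lmodule.on omega1.

Definition dmono r (c : F^o) : omega1 := mono r ((c : F) *: intdeg r).
Lemma dmono_linear r : linear (dmono r).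
Proof. by move=> a x y; rewrite /dmono scalerDl linearD -scalerA linearZ. Qed.
HB.instance Definition _ r :=
  GRing.isLinear.Build F F^o omega1 *:%R (dmono r) (dmono_linear r).

Definition dlaurent : loop F^o -> omega1 := ext dmono.
Lemma dlaurent_linear : linear dlaurent.
Proof. by apply: ext_linear => r; exact: linearP. Qed.
HB.instance Definition _ :=
  GRing.isLinear.Build F (loop F^o) omega1 *:%R dlaurent dlaurent_linear.

Definition exact_form : {pred omega1} :=
  fun w => `[< exists f, w = dlaurent f >].
Lemma exact_form_submod : submod_closed exact_form.
Proof.
split=> [|a _ _ /asboolP[f ->] /asboolP[h ->]]; apply/asboolP.
  by exists 0; rewrite linear0.
by exists (a *: f + h); rewrite linearP.
Qed.
HB.instance Definition _ :=
  GRing.isSubmodClosed.Build F omega1 exact_form exact_form_submod.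

Definition kahler := Quotient.quot exact_form.
HB.instance Definition _ := GRing.Zmodule.on kahler.
Definition kclass (w : omega1) : kahler := \pi_kahler%qT w.
Definition krepr (x : kahler) : omega1 := repr x.

Lemma kreprK : cancel krepr kclass.
Proof. exact: reprK. Qed.
Lemma kclassP (v w : omega1) : kclass v = kclass w <-> v - w \in exact_form.
Proof. by rewrite Quotient.idealrBE; split=> /eqP. Qed.
Lemma kclassD v w : kclass (v + w) = kclass v + kclass w.
Proof. by rewrite /kclass; exact: pi_addr. Qed.

Definition kscale a (x : kahler) : kahler := kclass (a *: krepr x).

Lemma kscaleE a w : kscale a (kclass w) = kclass (a *: w).
Proof.
by apply/kclassP; rewrite -scalerBr rpredZ //; apply/kclassP; rewrite kreprK.
Qed.
Lemma kscaleA a b x : kscale a (kscale b x) = kscale (a * b) x.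
Proof. by rewrite -(kreprK x) !kscaleE scalerA. Qed.
Lemma kscale1 : left_id 1 kscale.
Proof. by move=> x; rewrite -(kreprK x) !kscaleE scale1r. Qed.
Lemma kscaleDr : right_distributive kscale +%R.
Proof.
move=> a x y; rewrite -(kreprK x) -(kreprK y) -kclassD !kscaleE.
by rewrite scalerDr kclassD.
Qed.
Lemma kscaleDl x : {morph kscale^~ x : a b / a + b}.
Proof.
by move=> a b; rewrite /= -(kreprK x) !kscaleE scalerDl kclassD.
Qed.
HB.instance Definition _ := GRing.Zmodule_isLmodule.Build F kahler
  kscaleA kscale1 kscaleDr kscaleDl.

Lemma kclass_linear : linear kclass.
Proof. by move=> a v w; rewrite kclassD -kscaleE. Qed.
HB.instance Definition _ :=
  GRing.isLinear.Build F omega1 kahler *:%R kclass kclass_linear.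

Lemma kclass_dmono r c : kclass (mono r (c *: intdeg r)) = 0.
Proof.
rewrite -(linear0 kclass); apply/kclassP; rewrite subr0.
apply/asboolP; exists (mono r (c : F^o)); rewrite /dlaurent ext_mono //.
by move=> s; exact: linearP.
Qed.
End Kahler.

Section Linear.
Variables (F : fieldType) (U V W : lmodType F).

Lemma lin0 : linear (fun _ : U => 0 : V).
Proof. by move=> a x y; rewrite scaler0 addr0. Qed.
Lemma linD (f h : U -> V) :
  linear f -> linear h -> linear (fun x => f x + h x).
Proof.
by move=> fl hl a x y; rewrite fl hl scalerDr addrACA.
Qed.
Lemma linN (f : U -> V) : linear f -> linear (fun x => - f x).
Proof. by move=> fl a x y; rewrite fl opprD scalerN. Qed.
Lemma linZ (f : U -> V) k : linear f -> linear (fun x => k *: f x).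
Proof. by move=> fl a x y; rewrite fl scalerDr !scalerA mulrC. Qed.
Lemma lin_comp (f : V -> W) (h : U -> V) :
  linear f -> linear h -> linear (fun x => f (h x)).
Proof. by move=> fl hl a x y; rewrite hl fl. Qed.
End Linear.

Section Killing.
Variables (F : fieldType) (g : finLieAlgType F).
Implicit Types (x y z : g) (f h : g -> g).

Lemma killing_linearr x : linear (killing x : g -> F^o).
Proof.
move=> a y z; rewrite /killing /endo_trace scaler_sumr -big_split.
apply: eq_bigr => i _ /=.
by rewrite lieDl lieZl !linearP.
Qed.

Lemma endo_traceC f h : linear f -> linear h ->
  endo_trace (f \o h) = endo_trace (h \o f).
Proof.
have tr2 (f1 h1 : g -> g) : linear f1 -> endo_trace (f1 \o h1) =
  \sum_(i < \dim {:g}) \sum_(j < \dim {:g}) coord (vbasis {:g}) j (h1 (vbasis {:g})`_i) *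
                coord (vbasis {:g}) i (f1 (vbasis {:g})`_j).
  move=> fl; pose Lf := GRing.isLinear.Build F g g *:%R f1 fl.
  pose f' : {linear g -> g} := HB.pack f1 Lf.
  apply: eq_bigr => i _ /=.
  have -> : f1 (h1 (vbasis {:g})`_i) = f' (h1 (vbasis {:g})`_i) by [].
  rewrite {1}(coord_vbasis (memvf (h1 (vbasis {:g})`_i))) !linear_sum.
  by apply: eq_bigr => j _; rewrite !linearZ.
move=> fl hl; rewrite !tr2 // exchange_big /=.
by apply: eq_bigr => i _; apply: eq_bigr => j _; rewrite mulrC.
Qed.

Lemma killingC x y : killing x y = killing y x.
Proof. by apply: endo_traceC; exact: linearP. Qed.

Lemma endo_traceB f h :
  endo_trace (fun x => f x - h x) = endo_trace f - endo_trace h.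
Proof.
by rewrite /endo_trace -sumrB; apply: eq_bigr => i _; rewrite linearB.
Qed.

Lemma lie_lie x y z : lie (lie x y) z = lie x (lie y z) - lie y (lie x z).
Proof.
have /eqP := lie_jacobi x y z.
rewrite (lieC z (lie x y)) subr_eq0 => /eqP <-.
by rewrite (lieC z x) linearN.
Qed.

Lemma killing_inv x y z : killing (lie x y) z = killing x (lie y z).
Proof.
have e1 : killing (lie x y) z =
    endo_trace (fun t => lie x (lie y (lie z t)) - lie y (lie x (lie z t))).
  by rewrite /killing /endo_trace; apply: eq_bigr => i _; rewrite /= lie_lie.
have e2 : killing x (lie y z) =
    endo_trace (fun t => lie x (lie y (lie z t)) - lie x (lie z (lie y t))).
  rewrite /killing /endo_trace; apply: eq_bigr => i _.
  by rewrite /= lie_lie linearB.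
rewrite e1 e2 !endo_traceB; congr (_ - _).
apply: (@endo_traceC (lie y) (lie x \o lie z)); first exact: linearP.
by apply: lin_comp; exact: linearP.
Qed.

Lemma killing_linearl y : linear (fun x : g => killing x y : F^o).
Proof. by move=> a x z; rewrite killingC killing_linearr -!(killingC y). Qed.

End Killing.

Lemma linfun_linear (F : fieldType) (U V : vectType F) (f : U -> V) :
  linear f -> linfun f =1 f.
Proof.
move=> fl; pose Lf := GRing.isLinear.Build F U V *:%R f fl.
pose f' : {linear U -> V} := HB.pack f Lf.
exact: (lfunE f').
Qed.

Lemma killing_flatE (F : fieldType) (g : finLieAlgType F) (H : {vspace g})
    (x y : subvs_of H) :
  killing_flat H x y = killing (vsval x) (vsval y).
Proof.
have linr (z : subvs_of H) :
    linear (fun t : subvs_of H => killing (vsval z) (vsval t) : F^o).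
  by move=> a t t'; rewrite linearP killing_linearr.
rewrite /killing_flat linfun_linear => [|a z z']; first exact: linfun_linear.
apply/lfunP => t; rewrite add_lfunE scale_lfunE !linfun_linear //.
by rewrite linearP killing_linearl.
Qed.

Section Toroidal.
Variables (F : numFieldType) (g : finLieAlgType F).

Local Notation C2 := 'rV[F]_2.

Definition weight (c : C2) (r : degree) : F := \sum_j c 0 j * (r 0 j)%:~R.

(* The action of c_0 d_0 + c_1 d_1, where d_j = t_j d/dt_j; [kderiv] is the map
   it induces on differentials modulo exact ones. *)
Definition deriv (V : lmodType F) (c : C2) : loop V -> loop V :=
  ext (fun r x => mono r (weight c r *: x)).

Definition kderiv (c : C2) (w : kahler F) : kahler F :=
  kclass (deriv c (krepr w)).

Definition loop_lie (u v : loop g) : loop g :=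
  ext (fun p x => ext (fun q y => mono (p + q) (lie x y)) v) u.

(* The bilinear extension of (x (x) f, y (x) h) |-> (x, y) h df. *)
Definition cocycle (u v : loop g) : kahler F :=
  ext (fun p x => ext (fun q y =>
    kclass (mono (p + q) (killing x y *: intdeg F p))) v) u.

Section Bilinear.
Variables (V W : lmodType F) (B : degree -> degree -> V -> V -> W).
Hypothesis Bl : forall p q y, linear (fun x => B p q x y).
Hypothesis Br : forall p q x, linear (B p q x).

Definition ext2 (u v : loop V) : W :=
  ext (fun p x => ext (fun q y => B p q x y) v) u.

Lemma ext2_linearl v : linear (fun u => ext2 u v).
Proof.
apply: ext_linear => p a x y.
by apply: ext_linear_fun => q z; rewrite Bl.
Qed.

Lemma ext2_linearr u : linear (ext2 u).
Proof.
move=> a v w; apply: ext_linear_fun => p x.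
exact: (ext_linear (fun q => Br p q x)).
Qed.

Lemma ext2_mono p q x y : ext2 (mono p x) (mono q y) = B p q x y.
Proof.
rewrite /ext2 ext_mono => [|r a z t]; first by rewrite ext_mono.
by apply: ext_linear_fun => s w; rewrite Bl.
Qed.
End Bilinear.

Let lB p q (x y : g) : loop g := mono (p + q) (lie x y).
Let kB p q (x y : g) : kahler F :=
  kclass (mono (p + q) (killing x y *: intdeg F p)).

Let lBl p q y : linear (fun x => lB p q x y).
Proof. apply: lin_comp; [exact: linearP|exact: lie_linearl]. Qed.
Let lBr p q x : linear (lB p q x).
Proof. apply: lin_comp; exact: linearP. Qed.
Let kBl p q y : linear (fun x => kB p q x y).
Proof.
apply: lin_comp; first exact: linearP.
apply: lin_comp; first exact: linearP.
by move=> a x z; rewrite killing_linearl scalerDl scalerA.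
Qed.
Let kBr p q x : linear (kB p q x).
Proof.
apply: lin_comp; first exact: linearP.
apply: lin_comp; first exact: linearP.
by move=> a y z; rewrite killing_linearr scalerDl scalerA.
Qed.

Lemma loop_lie_linearl v : linear (loop_lie^~ v).
Proof. exact: (ext2_linearl lBl). Qed.
Lemma loop_lie_linearr u : linear (loop_lie u).
Proof. exact: (ext2_linearr lBr). Qed.
Lemma loop_lie_mono p q x y :
  loop_lie (mono p x) (mono q y) = mono (p + q) (lie x y).
Proof. exact: (ext2_mono lBl lBr). Qed.
Lemma cocycle_linearl v : linear (cocycle^~ v).
Proof. exact: (ext2_linearl kBl). Qed.
Lemma cocycle_linearr u : linear (cocycle u).
Proof. exact: (ext2_linearr kBr). Qed.
Lemma cocycle_mono p q x y : cocycle (mono p x) (mono q y) =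
  kclass (mono (p + q) (killing x y *: intdeg F p)).
Proof. exact: (ext2_mono kBl kBr). Qed.

Section Deriv.
Variable V : lmodType F.
Lemma deriv_lin c r : linear (fun x : V => mono r (weight c r *: x)).
Proof. apply: lin_comp; [exact: linearP | by apply: linZ; exact: (linearP idfun)]. Qed.
Lemma deriv_linear c : linear (@deriv V c).
Proof. by apply: ext_linear => r; exact: deriv_lin. Qed.
Lemma deriv_mono c r (x : V) : deriv c (mono r x) = mono r (weight c r *: x).
Proof. by rewrite /deriv ext_mono // => s; exact: deriv_lin. Qed.
Lemma weight_linear r : linear ((weight^~ r) : C2 -> F^o).
Proof.
move=> a c d; rewrite /weight scaler_sumr -big_split; apply: eq_bigr => j _ /=.
by rewrite !mxE mulrDl -mulrA.
Qed.
Lemma weightD c p q : weight c (p + q) = weight c p + weight c q.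
Proof.
rewrite /weight -big_split; apply: eq_bigr => j _ /=.
by rewrite !mxE intrD mulrDr.
Qed.
Lemma deriv_linearc (u : loop V) : linear (fun c => deriv c u).
Proof.
move=> a c d; apply: ext_linear_fun => r x.
by rewrite weight_linear scalerDl linearD -scalerA linearZ.
Qed.
End Deriv.

Lemma deriv_exact c w : w \in @exact_form F -> deriv c w \in @exact_form F.
Proof.
move=> /asboolP[f ->]; apply/asboolP; exists (deriv c f).
suff : deriv c (dlaurent f) - dlaurent (deriv c f) = 0 by move/subr0_eq.
move: f; apply: loop_ext0 => [|r x].
  apply: linD; first by apply: lin_comp; [exact: deriv_linear|exact: linearP].
  by apply: linN; apply: lin_comp; [exact: linearP|exact: deriv_linear].
have dm s (y : F^o) : dlaurent (mono s y) = dmono s y.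
  by rewrite /dlaurent ext_mono // => t; exact: linearP.
by rewrite deriv_mono !dm /dmono deriv_mono scalerA subrr.
Qed.

Lemma kderiv_class c w : kderiv c (kclass w) = kclass (deriv c w).
Proof.
apply/kclassP.
have -> : deriv c (krepr (kclass w)) - deriv c w =
          deriv c (krepr (kclass w) - w).
  have := deriv_linear c (-1) w (krepr (kclass w)).
  by rewrite !scaleN1r ![- _ + _]addrC => ->.
by apply: deriv_exact; apply/kclassP; rewrite kreprK.
Qed.

Lemma kderiv_linear c : linear (kderiv c).
Proof.
move=> a v w; rewrite -(kreprK v) -(kreprK w) -linearP !kderiv_class.
by rewrite deriv_linear linearP.
Qed.
Lemma kderiv_linearc w : linear (fun c => kderiv c w).
Proof. by move=> a c d; rewrite /kderiv deriv_linearc linearP. Qed.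

(* (u, a, c) stands for u + a + c_0 d_0 + c_1 d_1. This is the untwisted algebra,
   of which the twisted ones are subalgebras. *)
Definition toroidal := (loop g * kahler F * C2)%type.
HB.instance Definition _ := GRing.Lmodule.on toroidal.

Definition toroidal_lie (X Y : toroidal) : toroidal :=
  let: (u, a, c) := X in let: (v, b, e) := Y in
  (loop_lie u v + (deriv c v - deriv e u),
   cocycle u v + (kderiv c b - kderiv e a), 0).

Lemma loop_lieC u v : loop_lie u v = - loop_lie v u.
Proof.
apply/eqP; rewrite -addr_eq0; apply/eqP; move: u; apply: loop_ext0 => [|p x].
  by apply: linD; [exact: loop_lie_linearl|exact: loop_lie_linearr].
move: v; apply: loop_ext0 => [|q y].
  by apply: linD; [exact: loop_lie_linearr|exact: loop_lie_linearl].
by rewrite !loop_lie_mono lieC (addrC q) linearN addNr.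
Qed.

Lemma cocycleC u v : cocycle u v = - cocycle v u.
Proof.
apply/eqP; rewrite -addr_eq0; apply/eqP; move: u; apply: loop_ext0 => [|p x].
  by apply: linD; [exact: cocycle_linearl|exact: cocycle_linearr].
move: v; apply: loop_ext0 => [|q y].
  by apply: linD; [exact: cocycle_linearr|exact: cocycle_linearl].
rewrite !cocycle_mono killingC (addrC q) -!linearD /=.
rewrite (_ : intdeg F p + intdeg F q = intdeg F (p + q)); first exact: kclass_dmono.
by apply/rowP => j; rewrite !mxE intrD.
Qed.

Lemma loop_jacobi u v w :
  loop_lie u (loop_lie v w) + loop_lie v (loop_lie w u)
  + loop_lie w (loop_lie u v) = 0.
Proof.
have ll := loop_lie_linearl; have lr := loop_lie_linearr.
move: u; apply: loop_ext0 => [|p x].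
  apply: linD; last exact: lin_comp.
  by apply: linD => //; apply: lin_comp.
move: v; apply: loop_ext0 => [|q y].
  apply: linD; last exact: lin_comp.
  by apply: linD => //; apply: lin_comp.
move: w; apply: loop_ext0 => [|r z].
  apply: linD => //.
  by apply: linD; apply: lin_comp.
rewrite !loop_lie_mono (addrC q (r + p)) -(addrA r) (addrC r (p + q)) -(addrA p).
by rewrite -!linearD lie_jacobi linear0.
Qed.

Lemma cocycle_jacobi u v w :
  cocycle u (loop_lie v w) + cocycle v (loop_lie w u)
  + cocycle w (loop_lie u v) = 0.
Proof.
have ll := loop_lie_linearl; have lr := loop_lie_linearr.
have kl := cocycle_linearl; have kr := cocycle_linearr.
move: u; apply: loop_ext0 => [|p x].
  apply: linD; last exact: lin_comp.
  by apply: linD => //; apply: lin_comp.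
move: v; apply: loop_ext0 => [|q y].
  apply: linD; last exact: lin_comp.
  by apply: linD => //; apply: lin_comp.
move: w; apply: loop_ext0 => [|r z].
  apply: linD => //.
  by apply: linD; apply: lin_comp.
rewrite !loop_lie_mono !cocycle_mono.
have -> : killing y (lie z x) = killing x (lie y z).
  by rewrite -killing_inv killingC.
have -> : killing z (lie x y) = killing x (lie y z).
  by rewrite killingC killing_inv.
rewrite (addrC q (r + p)) -(addrA r) (addrC r (p + q)) -(addrA p).
rewrite -!linearD /=.
rewrite (_ : intdeg F p + intdeg F q + intdeg F r = intdeg F (p + (q + r))); first exact: kclass_dmono.
by apply/rowP => j; rewrite !mxE !intrD addrA.
Qed.

Lemma deriv_loop_lie c u v :
  deriv c (loop_lie u v) = loop_lie (deriv c u) v + loop_lie u (deriv c v).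
Proof.
have ll := loop_lie_linearl; have lr := loop_lie_linearr.
have dl := @deriv_linear g c.
apply/eqP; rewrite -subr_eq0; apply/eqP; move: u; apply: loop_ext0 => [|p x].
  apply: linD; first exact: lin_comp.
  apply: linN; apply: linD => //.
  exact: (@lin_comp _ _ _ _ (fun t => loop_lie t v) (deriv c)).
move: v; apply: loop_ext0 => [|q y].
  apply: linD; first exact: lin_comp.
  apply: linN; apply: linD => //.
  exact: (@lin_comp _ _ _ _ (loop_lie (mono p x)) (deriv c)).
rewrite !(loop_lie_mono, deriv_mono) lieZl [lie _ (_ *: _)]linearZ -linearD.
by rewrite -scalerDl -weightD subrr.
Qed.

Lemma kderiv_cocycle c u v :
  kderiv c (cocycle u v) = cocycle (deriv c u) v + cocycle u (deriv c v).
Proof.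
have kl := cocycle_linearl; have kr := cocycle_linearr.
have dl := @deriv_linear g c; have kdl := kderiv_linear c.
apply/eqP; rewrite -subr_eq0; apply/eqP; move: u; apply: loop_ext0 => [|p x].
  apply: linD; first exact: lin_comp.
  apply: linN; apply: linD => //.
  exact: (@lin_comp _ _ _ _ (fun t => cocycle t v) (deriv c)).
move: v; apply: loop_ext0 => [|q y].
  apply: linD; first exact: lin_comp.
  apply: linN; apply: linD => //.
  exact: (@lin_comp _ _ _ _ (cocycle (mono p x)) (deriv c)).
rewrite !(cocycle_mono, deriv_mono) kderiv_class deriv_mono.
have kZl a : killing (a *: x) y = a * killing x y.
  have := killing_linearl y a x 0; rewrite addr0 => ->.
  by rewrite (linear_at0 (killing_linearl y)) addr0.
have kZr a : killing x (a *: y) = a * killing x y.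
  have := killing_linearr x a y 0; rewrite addr0 => ->.
  by rewrite (linear_at0 (killing_linearr x)) addr0.
rewrite kZl kZr -!linearD -scalerDl -mulrDl -weightD.
by rewrite scalerA subrr.
Qed.

Lemma derivC (V : lmodType F) c e (u : loop V) :
  deriv c (deriv e u) = deriv e (deriv c u).
Proof.
have dl c' := @deriv_linear V c'.
apply/eqP; rewrite -subr_eq0; apply/eqP; move: u; apply: loop_ext0 => [|p x].
  by apply: linD; [|apply: linN]; apply: lin_comp.
by rewrite !deriv_mono !scalerA mulrC subrr.
Qed.

Lemma kderivC c e w : kderiv c (kderiv e w) = kderiv e (kderiv c w).
Proof. by rewrite -(kreprK w) !kderiv_class derivC. Qed.

Lemma toroidal_linearl Y : linear (toroidal_lie^~ Y).
Proof.
move: Y => [[v b] e] k [[u a] c] [[u' a'] c'] /=.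
rewrite loop_lie_linearl deriv_linearc deriv_linear.
rewrite cocycle_linearl kderiv_linearc kderiv_linear.
congr (_, _, _); last by rewrite /= scaler0 addr0.
  by rewrite /= !opprD !scalerDr !scalerN [RHS]addrACA; congr (_ + _);
    rewrite addrACA.
by rewrite /= !opprD !scalerDr !scalerN [RHS]addrACA; congr (_ + _);
  rewrite addrACA.
Qed.

Lemma toroidal_lieC X Y : toroidal_lie X Y = - toroidal_lie Y X.
Proof.
move: X Y => [[u a] c] [[v b] e] /=.
congr (_, _, _); last by rewrite oppr0.
  by rewrite loop_lieC opprD opprB.
by rewrite cocycleC opprD opprB.
Qed.

Lemma toroidal_linearr X : linear (toroidal_lie X).
Proof.
move=> k Y Z; rewrite toroidal_lieC toroidal_linearl.
by rewrite opprD -scalerN -!toroidal_lieC.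
Qed.

Lemma toroidal_liexx X : toroidal_lie X X = 0.
Proof.
have /eqP := toroidal_lieC X X; rewrite -addr_eq0 -mulr2n -scaler_nat.
by rewrite scaler_eq0 pnatr_eq0 => /eqP.
Qed.

Let jacobi_sum (V : zmodType) (P1 P2 P3 cw vc eu we fv uf m1 m2 m3 : V) :
  P1 + P2 + P3 = 0 ->
  (P1 + (- eu - uf) + (cw + vc + (m1 - m2))) +
  (P2 + (- fv - vc) + (eu + we + (m3 - m1))) +
  (P3 + (- cw - we) + (fv + uf + (m2 - m3))) = 0.
Proof.
move=> PS; rewrite !addrA.
rewrite [LHS](ACl (1*8*15*(2*11)*(3*19)*(4*16)*(5*10)*(6*14)*(7*20)*(9*18)*
  (12*17)*(13*21))) /=.
by rewrite PS !(addNr, subrr, addr0).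
Qed.

Lemma toroidal_jacobi X Y Z :
  toroidal_lie X (toroidal_lie Y Z) + toroidal_lie Y (toroidal_lie Z X) +
  toroidal_lie Z (toroidal_lie X Y) = 0.
Proof.
move: X Y Z => [[u a] c] [[v b] e] [[w d] f] /=.
have d0 (V : lmodType F) (x : loop V) : deriv 0 x = 0.
  exact: (linear_at0 (deriv_linearc x)).
have k0 x : kderiv 0 x = 0 by exact: (linear_at0 (kderiv_linearc x)).
have sub2 (V W : lmodType F) (h : V -> W) : linear h ->
  forall x y z, h (x + (y - z)) = h x + (h y - h z).
  move=> hl x y z; pose Lh := GRing.isLinear.Build F V W *:%R h hl.
  pose h' : {linear V -> W} := HB.pack h Lh.
  by have := linearD h' x (y - z); rewrite linearB.
rewrite !(sub2 _ _ _ (loop_lie_linearr _), sub2 _ _ _ (cocycle_linearr _)).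
rewrite !(sub2 _ _ _ (deriv_linear _), sub2 _ _ _ (kderiv_linear _)).
rewrite !(d0, k0, subr0) !(deriv_loop_lie, kderiv_cocycle).
congr (_, _, _) => /=; last by rewrite !addr0.
  rewrite (loop_lieC u (deriv e w)) (loop_lieC v (deriv f u)).
  rewrite (loop_lieC w (deriv c v)) (derivC e c) (derivC f c) (derivC f e).
  by apply: jacobi_sum; exact: loop_jacobi.
rewrite (cocycleC u (deriv e w)) (cocycleC v (deriv f u)).
rewrite (cocycleC w (deriv c v)) (kderivC e c) (kderivC f c) (kderivC f e).
by apply: jacobi_sum; exact: cocycle_jacobi.
Qed.

HB.instance Definition _ := isLieAlgebra.Build F toroidal
  toroidal_linearl toroidal_linearr toroidal_liexx toroidal_jacobi.

End Toroidal.

(* Indices run from 0.  For [TypeB], [TypeC], [TypeF4] and [TypeG2] the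
   numbering is Bourbaki's; in types D and E the nodes 0, ..., l - 2 form a
   chain and the node l - 1 is attached to the node l - 3, respectively 2. *)
Variant dynkin_type :=
  TypeA of nat | TypeB of nat | TypeC of nat | TypeD of nat
| TypeE of nat | TypeF4 | TypeG2.

Definition dynkin_rank X : nat :=
  match X with
  | TypeA l | TypeB l | TypeC l | TypeD l | TypeE l => l
  | TypeF4 => 4
  | TypeG2 => 2
  end.

Definition dynkin_valid X : bool :=
  match X with
  | TypeA l => (1 <= l)%N
  | TypeB l | TypeC l => (2 <= l)%N
  | TypeD l => (3 <= l)%N
  | TypeE l => (6 <= l <= 8)%N
  | TypeF4 | TypeG2 => true
  end.

Definition dynkin_edge X (i j : nat) : bool :=
  let chain i j := (i.+1 == j) || (j.+1 == i) in
  let fork b l i j :=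
    [|| [&& chain i j, (i < l.-1)%N & (j < l.-1)%N],
        (i == b) && (j == l.-1) | (j == b) && (i == l.-1)] in
  match X with
  | TypeD l => fork (l - 3)%N l i j
  | TypeE l => fork 2%N l i j
  | _ => chain i j
  end.

(* The entry (i, j) is 2 (a_i, a_j) / (a_i, a_i) = a_j (a_i^vee). *)
Definition cartan_matrix X : 'M[int]_(dynkin_rank X) :=
  \matrix_(i, j)
    if i == j then 2 else if ~~ dynkin_edge X i j then 0 else
    match X with
    | TypeB l => if (i == l.-1 :> nat) then -2 else -1
    | TypeC l => if (j == l.-1 :> nat) then -2 else -1
    | TypeF4 => if (i == 2%N :> nat) && (j == 1%N :> nat) then -2 else -1
    | TypeG2 => if (i == 0%N :> nat) then -3 else -1
    | _ => -1
    end.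

Section CartanType.
Variables (F : fieldType) (g : finLieAlgType F).

Definition root_base (H : {vspace g}) n
    (s : n.-tuple 'Hom(subvs_of H, F^o)) :=
  [/\ basis_of fullv s, forall i, root_system H (tnth s i) &
      forall a, root_system H a -> exists c : 'I_n -> nat,
        a = \sum_i tnth s i *+ c i \/ a = - \sum_i tnth s i *+ c i].

Definition has_type (X : dynkin_type) :=
  exists H : {vspace g}, cartan_subalgebra fullv H /\
  exists s : (dynkin_rank X).-tuple 'Hom(subvs_of H, F^o),
    root_base s /\
    forall i j, 2 * dual_killing (tnth s i) (tnth s j) =
      (cartan_matrix X i j)%:~R * dual_killing (tnth s i) (tnth s i).

End CartanType.

Section Twisted.
Variables (R : realType) (g : finLieAlgType R[i]).

Definition lie_automorphism (f : 'End(g)) :=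
  lker f = 0%VS /\ forall x y, f (lie x y) = lie (f x) (f y).

Definition has_order (f : g -> g) (n : nat) :=
  [/\ (0 < n)%N, iter n f =1 id &
      forall m, (0 < m < n)%N -> ~ (iter m f =1 id)].

Record twist := Twist {
  taut : 'I_2 -> 'End(g);
  tord : 'I_2 -> nat;
  taut_auto : forall j, lie_automorphism (taut j);
  taut_comm : forall x, taut 0 (taut 1 x) = taut 1 (taut 0 x);
  taut_order : forall j, has_order (taut j) (tord j) }.

Lemma id_auto : lie_automorphism \1%VF.
Proof.
split=> [|x y]; last by rewrite !id_lfunE.
by apply/eqP/lker0P => x y; rewrite !id_lfunE.
Qed.
Lemma id_order : has_order (\1%VF : 'End(g)) 1.
Proof. by split=> // [x|[|m]] //=; rewrite id_lfunE. Qed.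
Definition id_twist : twist :=
  @Twist (fun=> \1%VF) (fun=> 1%N) (fun=> id_auto) (fun=> erefl)
    (fun=> id_order).

(* exp (2 pi i / n) *)
Definition epsilon (n : nat) : R[i] :=
  (cos (2 * pi / n%:R) +i* sin (2 * pi / n%:R))%C.

Variable s : twist.

Definition graded (r : degree) : {vspace g} :=
  let eigen j := passmx.leigenspace (taut s j) (epsilon (tord s j) ^ (r 0 j)) in
  (\bigcap_j eigen j)%VS.

Definition kahler_sigma : set (kahler R[i]) :=
  [set kclass w | w in
    [set w : omega1 R[i] | forall r, w r != 0 ->
       exists a : degree, forall j, r 0 j = (tord s j)%:Z * a 0 j]].

Definition twisted_toroidal : set (toroidal g) :=
  [set x : toroidal g | (forall r, x.1.1 r \in graded r) /\ kahler_sigma x.1.2].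

Variable H : {vspace g}.

(* (h, c, a) stands for h + c_0 d_0 + c_1 d_1 + a_0 k_0 + a_1 k_1. *)
Definition cartan := (subvs_of H * 'rV[R[i]]_2 * 'rV[R[i]]_2)%type.
HB.instance Definition _ := Vector.on cartan.

Definition cartan_incl (h : cartan) : toroidal g :=
  (mono 0 (vsval h.1.1), kclass (mono 0 h.2), h.1.2).

Local Notation dualH := 'Hom(subvs_of H, (R[i])^o).
Local Notation dual := 'Hom(cartan, (R[i])^o).

Definition extend0 (a : dualH) : dual := linfun (fun h : cartan => a h.1.1).
Definition delta (j : 'I_2) : dual := linfun (fun h : cartan => h.1.2 0 j : (R[i])^o).

Definition restrictH (b : dual) : dualH :=
  linfun (fun h : subvs_of H => b ((h, 0), 0)).

Definition spaceV : set dual :=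
  [set b | exists a c0 c1, b = extend0 a + c0 *: delta 0 + c1 *: delta 1].

Definition formV (b b' : dual) : R[i] := dual_killing (restrictH b) (restrictH b').

Definition weight_space (b : dual) : set (toroidal g) :=
  [set x : toroidal g | twisted_toroidal x /\
           forall h : cartan, lie (cartan_incl h) x = b h *: x].

Definition nonisotropic_roots : set dual :=
  [set b | [/\ spaceV b, formV b b != 0 &
               exists2 x : toroidal g, x != 0 & weight_space b x]].

End Twisted.

Arguments kahler_sigma {R g} s _.
Arguments twisted_toroidal {R g} s _.
Arguments spaceV {R g} H _.
Arguments weight_space {R g} s H b _.
Arguments nonisotropic_roots {R g} s H _.

(* Main.v *)
Require Import Defs.
From HB Require Import structures.
From mathcomp Require Import all_boot all_order all_algebra ring.
From mathcomp Require Import complex.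
From mathcomp Require Import all_classical all_reals all_analysis.

(** Elements of H act trivially on the central and derivation components, and on
g (x) t^r by the adjoint action, while d_0 and d_1 read off the degree r.  So a
weight vector of nonisotropic weight lies in the loop component, its coefficients
are root vectors of g, and the theorem reduces to: no root of g is isotropic for
the form dual to the Killing form.

For this, Cartan's criterion comes first: if the Killing form vanishes and
g = [g, g], then tr (ad h S) = 0 for S the complex conjugate of the semisimple
part of ad h, so ad h is nilpotent for all h; by Engel's argument g would equal
its nilpotent subalgebra H.  Hence the Killing form of a simple g is
nondegenerate, and also nondegenerate on H, because the Fitting decomposition of
g under ad H is orthogonal and its null component is H.  If x is a root vector
of root a, dual to t in H, a Fitting decomposition for the weight -a gives y with
(x, y) <> 0 and [x, y] in H, so that [x, y] = (x, y) t.  If a(t) = 0, then [x, y]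
commutes with x, hence is ad-nilpotent by Jacobson's lemma; being central in H it
is then orthogonal to H, a contradiction. *)

Import Order.TTheory GRing.Theory Num.Theory.
Local Open Scope ring_scope.

Set Implicit Arguments.
Unset Strict Implicit.
Unset Printing Implicit Defensive.

(** * Complex matrices and their eigenvalues *)

(** The eigenvalues of [A] with multiplicity, recorded only through their effect on polynomials in
    [A]. *)
Definition spectrum (C : numClosedFieldType) n (A : 'M[C]_n.+1) (d : 'I_n.+1 -> C) :=
  [/\ horner_mx A (\prod_i ('X - (d i)%:P)) = 0,
      forall p, \tr (horner_mx A p) = \sum_i p.[d i] &
      forall p, horner_mx A p = 0 -> forall i, p.[d i] = 0].

Lemma horner_mx_trig (F : fieldType) n (A : 'M[F]_n.+1) p : is_trig_mx A ->
  is_trig_mx (horner_mx A p) /\ forall i, horner_mx A p i i = p.[A i i].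
Proof.
move=> /is_trig_mxP At; elim/poly_ind: p => [|p c [/is_trig_mxP pt pd]].
  by rewrite rmorph0; split=> [|i]; rewrite ?mx0_is_trig ?mxE ?horner0.
rewrite rmorphD rmorphM /= horner_mx_X horner_mx_C.
split=> [|i]; first apply/is_trig_mxP => i j ij.
  rewrite !mxE -val_eqE ltn_eqF // addr0 big1 // => k _.
  by case: (ltnP i k) => [/pt -> | ki]; rewrite ?mul0r // At ?mulr0 // (leq_ltn_trans ki).
rewrite !mxE eqxx !hornerE -pd; congr (_ + _).
rewrite (bigD1 i) //= big1 ?addr0 // => k; rewrite -val_eqE neq_ltn.
by case/orP => [/At ->|/pt ->]; rewrite ?mulr0 ?mul0r.
Qed.

(** Schur's theorem makes [A] similar to a triangular matrix, whose diagonal serves as [d]. *)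
Lemma spectrum_exists (C : numClosedFieldType) n (A : 'M[C]_n.+1) :
  exists d, spectrum A d.
Proof.
have [P /unitarymx_unit Pu At] := Schur A (ltn0Sn n).
pose T := conjmx P A; exists (fun i => T i i).
have Ap p : horner_mx T p = conjmx P (horner_mx A p) by rewrite /T !conjumx ?horner_mx_uconj.
have A0 p : horner_mx A p = 0 <-> horner_mx T p = 0.
  rewrite Ap; split=> [->|]; first by rewrite conjmx0.
  by move=> /(congr1 (conjmx (invmx P))); rewrite conjmx0 conjmxK.
have Tp p := horner_mx_trig p At.
split=> [|p|p /A0 p0 i].
- by apply/A0; rewrite -char_poly_trig // Cayley_Hamilton.
- transitivity (\tr (horner_mx T p)); last first.
    by apply: eq_bigr => i _; rewrite (Tp p).2.
  by rewrite Ap conjumx // mxtrace_mulC mulmxA mulVmx // mul1mx.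
- by rewrite -(Tp p).2 p0 mxE.
Qed.

Lemma nilpotent_mxtrace (C : numClosedFieldType) n (A : 'M[C]_n.+1) k :
  A ^+ k = 0 -> \tr A = 0.
Proof.
have [d [_ dt d0]] := spectrum_exists A; move=> Ak.
have := dt 'X; rewrite horner_mx_X => ->; apply: big1 => i _; rewrite hornerX.
have /(d0 'X^k)/(_ i)/eqP : horner_mx A 'X^k = 0 by rewrite rmorphXn /= horner_mx_X.
by rewrite hornerXn expf_eq0 => /andP[_ /eqP].
Qed.

(* The trace is the sum of the [`|d i| ^+ 2]. *)
Lemma conj_trace_nilpotent (C : numClosedFieldType) n (A : 'M[C]_n.+1) d f :
  spectrum A d -> (forall i, f.[d i] = (d i)^*) ->
  \tr (A *m horner_mx A f) = 0 -> A ^+ n.+1 = 0.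
Proof.
move=> [dA dt _] fd; have -> : A *m horner_mx A f = horner_mx A ('X * f).
  by rewrite rmorphM /= horner_mx_X.
rewrite dt => s0.
have d0 i : d i = 0.
  apply/eqP; rewrite -normr_eq0 -sqrf_eq0 normCK.
  have := @psumr_eq0P C 'I_n.+1 xpredT (fun i => d i * (d i)^*).
  move=> /(_ (fun i _ => mul_conjC_ge0 (d i))) -> //.
  by rewrite -[RHS]s0; apply: eq_bigr => j _; rewrite hornerM hornerX fd.
have : horner_mx A ('X ^+ n.+1) = 0.
  rewrite -[RHS]dA; congr (horner_mx A _).
  by rewrite (eq_bigr (fun=> 'X)) ?prodr_const ?card_ord// => i _; rewrite d0 subr0.
by rewrite rmorphXn /= horner_mx_X.
Qed.

(** Chinese remainders, node by node: [u * q] is 1 modulo the power at the new node [a] and 0 modulo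
    the powers at the older ones, so the correction term preserves the latter. *)
Lemma hermite_interpolation (F : fieldType) (h : F -> F) (s : seq F) N :
  exists f : {poly F}, forall l, l \in s -> ('X - l%:P) ^+ N %| f - (h l)%:P.
Proof.
elim: s => [|a s [f fs]]; first by exists 0.
have [as_|as_] := boolP (a \in s).
  by exists f => l; rewrite inE => /orP[/eqP ->|]; exact: fs.
pose q := \prod_(l <- s) ('X - l%:P) ^+ N.
have cop : coprimep q (('X - a%:P) ^+ N).
  apply/coprimep_expr; rewrite coprimep_XsubC /root /q horner_prod prodf_seq_neq0.
  apply/allP => l ls; rewrite /= horner_exp expf_neq0 // hornerXsubC subr_eq0.
  by apply: contraNneq as_ => ->.
have [[u v] /= uv] := Bezout_eq1_coprimepP _ _ cop.
exists (f + u * q * ((h a)%:P - f)) => l; rewrite inE => /orP[/eqP ->|ls].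
  have -> : u * q = 1 - v * ('X - a%:P) ^+ N by rewrite -uv addrK.
  rewrite [X in _ %| X](_ : _ = v * ('X - a%:P) ^+ N * (f - (h a)%:P)); last first.
    by move: (v * _) (h a)%:P => w c; ring.
  by rewrite mulrAC dvdp_mull.
rewrite addrAC dvdp_addr ?fs // dvdp_mulr // dvdp_mull // /q.
by rewrite (big_rem l ls) dvdp_mulr.
Qed.

(* Jacobson's lemma: C commutes with A, so tr (C f(C)) = tr [A, B f(C)] = 0. *)
Lemma comm_commutator_nilpotent (C : numClosedFieldType) n (A B : 'M[C]_n.+1) :
  GRing.comm A (A * B - B * A) -> (A * B - B * A) ^+ n.+1 = 0.
Proof.
set D := A * B - B * A => AD; have [d dP] := spectrum_exists D.
have [f ff] := hermite_interpolation (fun l : C => l^*) (codom d) 1.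
apply: (conj_trace_nilpotent (f := f) dP) => [i|].
  have /ff : d i \in codom d by apply: codom_f.
  by rewrite expr1 dvdp_XsubCl /root !hornerE subr_eq0 => /eqP.
have DA : GRing.comm A (horner_mx D f) by apply: comm_mx_horner.
rewrite {1}/D mulmxBl linearB /= -!mulmxE -!mulmxA (mxtrace_mulC A) -!mulmxA.
by rewrite [A *m horner_mx D f]DA subrr.
Qed.

(** * Lie algebras with a Cartan subalgebra *)

Lemma matrix_coordinates (F : fieldType) (g : finLieAlgType F) :
  (exists x : g, x != 0) ->
  exists (n : nat) (phi : {linear g -> 'rV[F]_n.+1}) (psi : {linear 'rV[F]_n.+1 -> g}),
    [/\ cancel phi psi, cancel psi phi &
        forall f : {linear g -> g}, endo_trace f = \tr (lin1_mx (phi \o f \o psi))].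
Proof.
(* Positive dimension gives matrices of size [n.+1], which form a ring, so polynomials can be
   evaluated at them. *)
case=> x x0; have : (0 < \dim {:g})%N.
  by rewrite lt0n dimv_eq0; apply: contraNneq x0 => g0; rewrite -memv0 -g0 memvf.
rewrite /endo_trace; move: (vbasisP {:g}); move: (vbasis {:g}).
case: (\dim {:g}) => // n e eb _.
pose phi v : 'rV[F]_n.+1 := \row_i coord e i v.
pose psi (r : 'rV[F]_n.+1) := \sum_i r 0 i *: e`_i.
have phil : linear phi by move=> a u v; apply/rowP => i; rewrite !mxE linearP.
have psil : linear psi.
  move=> a u v; rewrite /psi scaler_sumr -big_split; apply: eq_bigr => i _ /=.
  by rewrite !mxE scalerDl scalerA.
pose Lphi := GRing.isLinear.Build F g _ *:%R phi phil.
pose Lpsi := GRing.isLinear.Build F _ g *:%R psi psil.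
pose phi' : {linear g -> 'rV[F]_n.+1} := HB.pack phi Lphi.
pose psi' : {linear 'rV[F]_n.+1 -> g} := HB.pack psi Lpsi.
exists n, phi', psi'; split=> [v|r|f] /=.
- by rewrite /phi /psi [RHS](coord_basis eb (memvf v)); apply: eq_bigr => i _; rewrite mxE.
- by apply/rowP => i; rewrite mxE /psi coord_sum_free // (basis_free eb).
- apply: eq_bigr => i _; rewrite !mxE /=; congr (coord e i (f _)).
  rewrite /psi (bigD1 i) //= mxE !eqxx scale1r big1 ?addr0 // => j ji.
  by rewrite mxE (negPf ji) andbF scale0r.
Qed.

Section LieIdentities.
Variables (F : fieldType) (L : lieAlgType F).

Lemma lieBl (x y z : L) : lie (x - y) z = lie x z - lie y z.
Proof. by rewrite lieDl -scaleN1r lieZl scaleN1r. Qed.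
End LieIdentities.

Lemma lie_deriv (F : fieldType) (g : finLieAlgType F) (x y z : g) :
  lie x (lie y z) = lie (lie x y) z + lie y (lie x z).
Proof. by rewrite lie_lie subrK. Qed.

HB.instance Definition _ (F : fieldType) (g : finLieAlgType F) (x : g) :=
  GRing.isLinear.Build F g F^o *:%R (killing x) (killing_linearr x).

Section LieProd.
Variables (F : fieldType) (g : finLieAlgType F).
Implicit Types (U V H : {vspace g}) (x y : g).

Lemma lie_prodv_mem U V x y : x \in U -> y \in V -> lie x y \in lie_prodv U V.
Proof.
move=> xU yV; rewrite (coord_vbasis yV) linear_sum rpred_sum // => j _.
rewrite linearZ rpredZ //= lieC rpredN (coord_vbasis xU) linear_sum rpred_sum // => i _.
rewrite linearZ rpredZ //= lieC rpredN memv_span //.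
by apply: allpairs_f; rewrite mem_nth // size_tuple.
Qed.

Lemma lie_prodv_sub U V H : (forall x y, x \in U -> y \in V -> lie x y \in H) ->
  (lie_prodv U V <= H)%VS.
Proof.
move=> UV; apply/span_subvP => _ /allpairsP[[x y] /= [xU yV ->]].
by rewrite UV // vbasis_mem.
Qed.

Lemma simple_derived : simple_lie g -> lie_prodv {:g} {:g} = {:g}%VS.
Proof.
case=> [[x [y xy]] /(_ (lie_prodv {:g} {:g}))[u v _||//]].
  by rewrite lie_prodv_mem ?memvf.
move=> g0; have := lie_prodv_mem (memvf x) (memvf y).
by rewrite g0 memv0 (negPf xy).
Qed.
End LieProd.

(** * Adjoint matrices, generalised eigenspaces and Cartan's criterion *)

Section Coordinates.
Variables (C : numClosedFieldType) (g : finLieAlgType C) (n : nat).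
Variables (phi : {linear g -> 'rV[C]_n.+1}) (psi : {linear 'rV[C]_n.+1 -> g}).
Hypotheses (phiK : cancel phi psi) (psiK : cancel psi phi).
Hypothesis tr_phi :
  forall f : {linear g -> g}, endo_trace f = \tr (lin1_mx (phi \o f \o psi)).
Implicit Types (x y h u v w : g) (p q : {poly C}) (c : C).

Definition ad x : 'M[C]_n.+1 := lin1_mx (phi \o lie x \o psi).

Lemma adE x v : phi (lie x v) = phi v *m ad x.
Proof. by rewrite mul_rV_lin1 /= phiK. Qed.

Lemma mx_ext (M N : 'M[C]_n.+1) : (forall v, phi v *m M = phi v *m N) -> M = N.
Proof.
by move=> MN; apply/row_matrixP => i; rewrite !rowE -(psiK (delta_mx _ _)) MN.
Qed.

Lemma ad_linear : linear ad.
Proof.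
move=> a x y; apply: mx_ext => v.
by rewrite mulmxDr -scalemxAr -!adE lieDl lieZl linearP.
Qed.
HB.instance Definition _ := GRing.isLinear.Build C g _ *:%R ad ad_linear.

(* Matrices act on rows, which reverses products. *)
Lemma ad_lie x y : ad (lie x y) = ad y * ad x - ad x * ad y.
Proof.
apply: mx_ext => v; rewrite mulmxBr -!mulmxE !mulmxA -!adE -linearB.
by rewrite lie_lie.
Qed.

Lemma killing_ad x y : killing x y = \tr (ad x *m ad y).
Proof.
rewrite /killing (tr_phi (lie x \o lie y)) mxtrace_mulC; congr (\tr _).
by apply: mx_ext => v; rewrite mulmxA -!adE mul_rV_lin1 /= phiK.
Qed.

Definition pact x p v := psi (phi v *m horner_mx (ad x) p).

Lemma pact_linear x p : linear (pact x p).
Proof. by move=> a u v; rewrite /pact linearP mulmxDl -scalemxAl linearP. Qed.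
HB.instance Definition _ x p :=
  GRing.isLinear.Build C g g *:%R (pact x p) (pact_linear x p).

Lemma pactD x p q v : pact x (p + q) v = pact x p v + pact x q v.
Proof. by rewrite /pact rmorphD mulmxDr linearD. Qed.
Lemma pactM x p q v : pact x (p * q) v = pact x p (pact x q v).
Proof. by rewrite /pact mulrC rmorphM /= psiK -mulmxE mulmxA. Qed.
Lemma pactC x c v : pact x c%:P v = c *: v.
Proof. by rewrite /pact horner_mx_C mul_mx_scalar linearZ /= phiK. Qed.
Lemma pact1 x v : pact x 1 v = v.
Proof. by rewrite -[1]/(1%:P) pactC scale1r. Qed.
Lemma pact0 x v : pact x 0 v = 0.
Proof. by rewrite -[0]/(0%:P) pactC scale0r. Qed.
Lemma pactX x v : pact x 'X v = lie x v.
Proof. by rewrite /pact horner_mx_X -adE phiK. Qed.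
Lemma pact_XsubC x c v : pact x ('X - c%:P) v = lie x v - c *: v.
Proof. by rewrite -polyCN pactD pactX pactC scaleNr. Qed.

Lemma pact_dvd x p q v : p %| q -> pact x p v = 0 -> pact x q v = 0.
Proof. by case/dvdpP=> r ->; rewrite pactM => ->; rewrite linear0. Qed.

(** By the Leibniz rule, ad x - (a + b) sends [u, v] to [(ad x - a) u, v] + [u, (ad x - b) v]; each
    term lowers [j] or [k], whence induction on [j + k]. *)
Lemma pact_lie x a b j k u v :
  pact x (('X - a%:P) ^+ j) u = 0 -> pact x (('X - b%:P) ^+ k) v = 0 ->
  pact x (('X - (a + b)%:P) ^+ (j + k)) (lie u v) = 0.
Proof.
move: {2}(j + k)%N (erefl (j + k)%N) => m; elim: m j k u v => [|m IH] [|j] [|k] u v //=.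
- by rewrite expr0 pact1 => _ ->; rewrite lie0l linear0.
- by rewrite expr0 pact1 => _ ->; rewrite lie0l linear0.
- by rewrite expr0 pact1 => _ _ ->; rewrite !linear0.
rewrite addSn => -[jk] uj vk.
have -> : ('X - (a + b)%:P) ^+ (j + k.+1).+1 =
  ('X - (a + b)%:P) ^+ (j + k.+1) * ('X - (a + b)%:P) by rewrite exprSr.
rewrite pactM.
have -> : pact x ('X - (a + b)%:P) (lie u v) =
  lie (pact x ('X - a%:P) u) v + lie u (pact x ('X - b%:P) v).
  rewrite !pact_XsubC lie_deriv lieBl lieZl.
  rewrite [lie u (_ - _)]linearB /= [lie u (_ *: _)]linearZ /=.
  by rewrite scalerDl opprD addrACA.
have uj' : pact x (('X - a%:P) ^+ j) (pact x ('X - a%:P) u) = 0.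
  by rewrite -pactM -exprSr.
have vk' : pact x (('X - b%:P) ^+ k) (pact x ('X - b%:P) v) = 0.
  by rewrite -pactM -exprSr.
rewrite linearD /= (IH j k.+1) // add0r addnS -addSn (IH j.+1 k) //.
by rewrite addSn -addnS.
Qed.

(* The null component [u] is a polynomial in [ad x] applied to [v], so it stays in
   every space stable under [ad x]. *)
Lemma fitting x c M v : exists q u w,
  [/\ v = pact x q v + pact x (('X - c%:P) ^+ M) w,
      u = pact x q v & exists k, pact x (('X - c%:P) ^+ k) u = 0].
Proof.
have [d [d0 _ _]] := spectrum_exists (ad x).
set p := \prod_i _ in d0.
have p0 : p != 0 by rewrite monic_neq0 // monic_prod_XsubC.
have [k [q qc pE]] := multiplicity_XsubC p c; rewrite p0 /= in qc.
have cop : coprimep q (('X - c%:P) ^+ M) by rewrite coprimep_expr // coprimep_XsubC.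
have [[a b] /= ab] := Bezout_eq1_coprimepP _ _ cop.
exists (a * q), (pact x (a * q) v), (pact x b v); split=> //.
  by rewrite -pactM -[(_ ^+ M) * b]mulrC -pactD ab pact1.
exists k; rewrite -pactM mulrCA [_ * q]mulrC -pE pactM.
by rewrite {2}/pact d0 mulmx0 !linear0.
Qed.

(** Bezout splits v along pairwise coprime factors. The additive predicate [P] stands in for a
    direct sum of eigenspaces. *)
Lemma primary_decomposition x (s : seq C) N (P : g -> Prop) : uniq s ->
  (forall u v, P u -> P v -> P (u + v)) -> P 0 ->
  (forall l v, l \in s -> pact x (('X - l%:P) ^+ N) v = 0 -> P v) ->
  forall v, pact x ((\prod_(l <- s) ('X - l%:P)) ^+ N) v = 0 -> P v.
Proof.
move=> + PD P0; elim: s => [_ _ v|a s IH /= /andP[as_ us] Ps v].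
  by rewrite big_nil expr1n pact1 => ->.
rewrite big_cons exprMn; set q := _ ^+ N in IH *; set r := _ ^+ N => v0.
have cop : coprimep r q.
  rewrite coprimep_expl // coprimep_expr // coprimep_sym coprimep_XsubC.
  by rewrite root_prod_XsubC.
have [[c b] /= cb] := Bezout_eq1_coprimepP _ _ cop.
rewrite -[v](pact1 x) -cb pactD; apply: PD.
  apply: IH => // [l w ls|]; first by apply: Ps; rewrite inE ls orbT.
  by rewrite -pactM mulrCA pactM (mulrC q) v0 linear0.
by apply: (Ps a); rewrite ?inE ?eqxx // -pactM mulrCA pactM v0 linear0.
Qed.

Lemma spectral_induction x d (P : g -> Prop) : spectrum (ad x) d ->
  (forall u v, P u -> P v -> P (u + v)) -> P 0 ->
  (forall i v, pact x (('X - (d i)%:P) ^+ n.+1) v = 0 -> P v) -> forall v, P v.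
Proof.
move=> [d0 _ _] PD P0 Pd v.
apply: (@primary_decomposition x (undup (codom d)) n.+1 P) => //.
- exact: undup_uniq.
- by move=> l w; rewrite mem_undup => /codomP[i ->]; exact: Pd.
(* Eigenvalues may repeat: each factor divides the product [Q] over distinct ones, so the full
   product divides [Q ^+ n.+1]. *)
- set Q := \prod_(l <- _) _; apply: (@pact_dvd x (\prod_i ('X - (d i)%:P))).
    have dQ i : 'X - (d i)%:P %| Q.
      rewrite /Q (big_rem (d i)) ?dvdp_mulr //=.
      by rewrite mem_undup codom_f.
    have : \prod_(i < n.+1) ('X - (d i)%:P) %| \prod_(i < n.+1) Q.
      by elim/big_rec2: _ => [|i q r _ qr]; rewrite ?dvdp_mul ?dvd1p.
    by rewrite prodr_const card_ord.
  by rewrite /pact d0 mulmx0 linear0.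
Qed.

(* Cartan's criterion.  [S], a polynomial in [ad h], is the complex conjugate of
   the semisimple part of [ad h]: on the generalised eigenspace of b it is the
   scalar b^*.  It satisfies [[S, ad y] = b^* ad y] when y is in the generalised
   eigenspace of b, so [tr (ad [x, y] S)] is a multiple of the Killing form. *)
Lemma killing0_nilpotent h : (forall x y, killing x y = 0) ->
  lie_prodv {:g} {:g} = {:g}%VS -> ad h ^+ n.+1 = 0.
Proof.
move=> k0 gg; have [d dP] := spectrum_exists (ad h).
(* A bracket of generalised eigenvectors has the sum of their eigenvalues, with doubled exponent;
   hence the extra nodes and the exponent [n.+1 + n.+1]. *)
pose s := codom d ++ [seq d i + d j | i <- enum 'I_n.+1, j <- enum 'I_n.+1].
have [f fs] := hermite_interpolation (fun l : C => l^*) s (n.+1 + n.+1).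
pose S := horner_mx (ad h) f.
have ds i : d i \in s by rewrite mem_cat codom_f.
have dds i j : d i + d j \in s.
  by rewrite mem_cat; apply/orP; right; apply: allpairs_f; rewrite mem_enum.
have Sl l v : l \in s -> pact h (('X - l%:P) ^+ (n.+1 + n.+1)) v = 0 ->
    phi v *m S = l^* *: phi v.
  move=> /fs lf v0; have := pact_dvd lf v0.
  rewrite -polyCN pactD pactC scaleNr => /eqP; rewrite subr_eq0 => /eqP.
  by rewrite /pact => /(congr1 phi); rewrite psiK linearZ.
have S1 i v : pact h (('X - (d i)%:P) ^+ n.+1) v = 0 -> phi v *m S = (d i)^* *: phi v.
  by move=> v0; apply: Sl; rewrite // exprD pactM v0 linear0.
apply: (conj_trace_nilpotent (f := f) dP) => [i|].
  have := fs _ (ds i); rewrite addSn exprS => /(dvdp_trans (dvdp_mulr _ (dvdpp _))).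
  by rewrite dvdp_XsubCl /root !hornerE subr_eq0 => /eqP.
rewrite -/S.
have S0 x y : \tr (ad (lie x y) *m S) = 0.
  move: y; apply: (spectral_induction dP) => [u v Su Sv||j y yj].
  - by rewrite !linearD /= mulmxDl linearD /= Su Sv addr0.
  - by rewrite !linear0 mul0mx linear0.
  have yS : ad y *m S = S *m ad y + (d j)^* *: ad y.
    apply: mx_ext => w; move: w.
    apply: (spectral_induction dP) => [u v Su Sv||i w wi].
    - by rewrite linearD /= !mulmxDl Su Sv.
    - by rewrite linear0 !mul0mx.
    rewrite mulmxDr !mulmxA -scalemxAr -adE (S1 i w) // -scalemxAl -adE -scalerDl.
    by rewrite addrC -rmorphD /= (Sl _ _ (dds j i)) ?pact_lie // addrC.
  rewrite ad_lie mulmxBl linearB /= -!mulmxE -!mulmxA mxtrace_mulC -mulmxA yS.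
  by rewrite mulmxDr linearD -scalemxAr linearZ /= -killing_ad k0 mulr0 addr0 subrr.
(* As g = [g, g], [h] is a combination of brackets, to which [S0] applies. *)
pose X := [seq lie x y | x <- vbasis {:g}, y <- vbasis {:g}].
have : h \in <<in_tuple X>>%VS by have := memvf h; rewrite -gg.
move=> /coord_span ->; rewrite linear_sum mulmx_suml linear_sum big1 // => i _.
rewrite linearZ -scalemxAl linearZ /=.
have : X`_i \in X by rewrite mem_nth.
by case/allpairsP=> [[x y] /= [_ _ ->]]; rewrite S0 mulr0.
Qed.

Definition geneigen x c v := exists k, pact x (('X - c%:P) ^+ k) v = 0.

Lemma geneigen0 x c : geneigen x c 0.
Proof. by exists 0%N; rewrite linear0. Qed.

Lemma geneigenD x c u v : geneigen x c u -> geneigen x c v -> geneigen x c (u + v).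
Proof.
move=> [j uj] [k vk]; exists (j + k)%N; rewrite linearD /=.
rewrite (pact_dvd _ uj) ?dvdp_exp2l ?leq_addr // (pact_dvd _ vk) ?addr0 //.
by rewrite dvdp_exp2l ?leq_addl.
Qed.

Lemma geneigenZ x c a v : geneigen x c v -> geneigen x c (a *: v).
Proof. by move=> [k vk]; exists k; rewrite linearZ /= vk scaler0. Qed.

(** Invariance makes ad x skew for the Killing form. This yields the orthogonality of Fitting
    components. *)
Lemma pact_lie_skew x c v w M :
  killing w (pact x (('X - c%:P) ^+ M) v) =
  (-1) ^+ M * killing (pact x (('X - (- c)%:P) ^+ M) w) v.
Proof.
elim: M v w => [|M IH] v w; first by rewrite !expr0 !pact1 mul1r.
rewrite exprSr pactM IH exprS [-1 * _]mulrC exprS pactM -mulrA; congr (_ * _).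
set w' := pact x _ w; rewrite !pact_XsubC scaleNr opprK.
rewrite linearB linearZ /= [killing (_ + _) _]killingC linearD linearZ /=.
by rewrite -killing_inv (lieC w') killingC linearN /= mulN1r opprD (killingC w').
Qed.

(** * Nilpotent self-normalising subalgebras: Fitting, Engel and nonisotropic roots *)

Section NilpotentSubalgebra.
Variables (H : {vspace g}) (K : nat).
Hypothesis H_lie : {in H &, forall x y, lie x y \in H}.
Hypothesis H_nil : iter K (lie_prodv H) H = 0%VS.

Local Notation lower k := (iter k (lie_prodv H) H).

Lemma lower_sub k : (lower k <= H)%VS.
Proof.
elim: k => //= k IH; apply: lie_prodv_sub => x y xH /(subvP IH); exact: H_lie.
Qed.

Lemma lower_decr k : (lower k.+1 <= lower k)%VS.
Proof.
elim: k => [|k IH]; first exact: (lower_sub 1).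
by apply: lie_prodv_sub => x y xH /(subvP IH) yk; exact: lie_prodv_mem.
Qed.

(** Each bracket with [h] descends one term of the lower central series. *)
Lemma nilpotent_pact h h' : h \in H -> h' \in H -> pact h (('X - 0%:P) ^+ K) h' = 0.
Proof.
move=> hH h'H; apply/eqP; rewrite -memv0 -H_nil.
elim: {1 2}K => [|k IH]; first by rewrite pact1.
by rewrite exprS pactM pact_XsubC scale0r subr0; exact: lie_prodv_mem.
Qed.

(** [h'] has generalised eigenvalue 0 under ad h, so bracketing with it adds 0 to [c]. *)
Lemma geneigen_stable h c h' v :
  h \in H -> h' \in H -> geneigen h c v -> geneigen h c (lie h' v).
Proof.
move=> hH h'H [k vk]; exists (K + k)%N.
by rewrite -[c in c%:P]add0r pact_lie // nilpotent_pact.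
Qed.

Lemma geneigen_pact h c h' p v :
  h \in H -> h' \in H -> geneigen h c v -> geneigen h c (pact h' p v).
Proof.
move=> hH h'H; elim/poly_ind: p v => [|p a IH] v vc.
  by rewrite pact0; exact: geneigen0.
rewrite pactD pactC pactM pactX; apply: geneigenD; last exact: geneigenZ.
by apply: IH; exact: geneigen_stable.
Qed.

(* The joint Fitting decomposition, with the sum of the images described by the
   fact that the functional [killing k] vanishes on it. *)
Lemma fitting_seq (L : seq (g * C)) M k v :
  (forall hc, hc \in L -> hc.1 \in H) ->
  (forall hc w, hc \in L -> killing k (pact hc.1 (('X - hc.2%:P) ^+ M) w) = 0) ->
  exists u, (forall hc, hc \in L -> geneigen hc.1 hc.2 u) /\ killing k u = killing k v.
Proof.
elim: L => [|[h c] L IH] LH Lk; first by exists v.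
have [||u [uL <-]] := IH.
- by move=> hc hcL; apply: LH; rewrite inE hcL orbT.
- by move=> hc w hcL; apply: Lk; rewrite inE hcL orbT.
have hH : h \in H by apply: (LH (h, c)); rewrite mem_head.
have [q [u' [w [uE u'E u'c]]]] := fitting h c M u.
exists u'; split=> [hc|].
  rewrite inE => /orP[/eqP -> //|hcL]; rewrite u'E; apply: geneigen_pact => //.
    by apply: LH; rewrite inE hcL orbT.
  exact: uL.
rewrite [u in RHS]uE -u'E linearD /=.
by rewrite (Lk (h, c) w) ?mem_head // addr0.
Qed.

Hypothesis H_self : forall x, {in H, forall h, lie x h \in H} -> x \in H.

(** A finite list containing a basis of every term of the lower central series, so that elements of
    H can be adjoined from the smallest term upwards. *)
Definition lower_basis : seq g := flatten [seq (vbasis (lower k) : seq g) | k <- iota 0 K].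

Lemma lower_basis_sub h : h \in lower_basis -> h \in H.
Proof.
by case/flatten_mapP=> k _ /vbasis_mem; apply/subvP; exact: lower_sub.
Qed.

Lemma span_lie_mem (U : {vspace g}) v :
  (forall h, h \in (vbasis U : seq g) -> lie h v \in H) ->
  forall h, h \in U -> lie h v \in H.
Proof.
move=> bH h hU; rewrite (coord_vbasis hU) lieC linear_sum rpredN rpred_sum // => i _.
by rewrite linearZ rpredZ //= lieC rpredN bH // mem_nth // size_tuple.
Qed.

(* Engel's argument on [g / H]: otherwise, adding the elements of [lower_basis]
   one by one, some v outside H would satisfy [[H, v] <= H]. *)
Lemma engel v : (forall h, h \in lower_basis -> geneigen h 0 v) -> v \in H.
Proof.
move=> v0; apply: contraT => vH.
pose good u := u \notin H /\ forall h, h \in lower_basis -> geneigen h 0 u.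
have step k (s : seq g) u : (k < K)%N -> {subset s <= (vbasis (lower k) : seq g)} ->
    good u -> (forall h, h \in lower k.+1 -> lie h u \in H) ->
    exists2 w, good w & (forall h, h \in lower k.+1 -> lie h w \in H) /\
      forall h, h \in s -> lie h w \in H.
  move=> kK + gu uk; elim: s => [_|h s IH sk]; first by exists u.
  have [|w gw [wk ws]] := IH; first by move=> t ts; apply: sk; rewrite inE ts orbT.
  have hk : h \in lower k by rewrite vbasis_mem // sk ?mem_head.
  have hH : h \in H by apply: (subvP (lower_sub k)).
  have hL : h \in lower_basis.
    by apply/flatten_mapP; exists k; rewrite ?mem_iota ?sk ?mem_head.
  have [m wm] := gw.2 h hL.
  (* Some iterate of ad h kills [w]; the last iterate outside H is the new vector. *)
  have : exists m, iter m (lie h) w \in H.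
    exists m; suff -> : iter m (lie h) w = 0 by rewrite mem0v.
    rewrite -{}wm; elim: m => [|m IHm]; first by rewrite pact1.
    by rewrite exprS pactM pact_XsubC scale0r subr0 /= IHm.
  case/ex_minnP => -[|l]; first by rewrite (negPf gw.1).
  move=> wl lmin.
  have inv i : (forall t, t \in lower_basis -> geneigen t 0 (iter i (lie h) w)) /\
      (forall t, t \in lower k.+1 -> lie t (iter i (lie h) w) \in H) /\
      (forall t, t \in s -> lie t (iter i (lie h) w) \in H).
    elim: i => [|i [I1 [I2 I3]]]; first by split; [exact: gw.2|].
    split=> [t tL|]; first by apply: geneigen_stable; rewrite ?lower_basis_sub //; exact: I1.
    (* [t, [h, w']] = [[t, h], w'] + [h, [t, w']], where [t, h] lies in the next term of the series,
       already known to send w' into H. *)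
    have hI t : t \in lower k -> lie t (iter i (lie h) w) \in H ->
        lie t (iter i.+1 (lie h) w) \in H.
      move=> tk tw; rewrite /= lie_deriv rpredD //; last exact: H_lie.
      by apply: I2; rewrite lieC rpredN; exact: lie_prodv_mem.
    split=> t tk; apply: hI.
    - by apply: (subvP (lower_decr k)).
    - exact: I2.
    - by rewrite vbasis_mem // sk // inE tk orbT.
    - exact: I3.
  exists (iter l (lie h) w).
    split; last exact: (inv l).1.
    by apply/negP => /lmin; rewrite ltnn.
  split; first exact: (inv l).2.1.
  by move=> t; rewrite inE => /orP[/eqP -> //|]; exact: (inv l).2.2.
(* Climb from the zero term [lower K] up to [lower 0], which is H. *)
have claim j : (j <= K)%N ->
    exists2 w, good w & forall h, h \in lower (K - j) -> lie h w \in H.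
  elim: j => [_|j IH jK].
    exists v => // h; rewrite subn0 H_nil memv0 => /eqP ->.
    by rewrite lie0l mem0v.
  have [|u gu] := IH; first exact: ltnW.
  rewrite (_ : K - j = (K - j.+1).+1)%N; last by rewrite subnSK.
  move=> /(step (K - j.+1)%N (vbasis (lower (K - j.+1)))).
  case=> //; first by rewrite -subSn ?subSS ?leq_subr.
  by move=> w gw [_ ws]; exists w => // h; exact: span_lie_mem.
have [w [wH _] wl] := claim K (leqnn K).
rewrite subnn in wl; case/negP: wH; apply: H_self => h hH.
by rewrite lieC rpredN wl.
Qed.

Hypothesis g_simple : simple_lie g.

(** The radical is an ideal. Were it all of g, Cartan's criterion and Engel would give g = H,
    nilpotent, against g = [g, g]. *)
Lemma killing_nondegenerate x : (forall y, killing x y = 0) -> x = 0.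
Proof.
move=> x0; pose kl y : 'rV[C]_n.+1 := \row_i killing y (psi (delta_mx 0 i)).
have kll : linear kl.
  by move=> b y z; apply/rowP => i; rewrite !mxE killing_linearl.
have klP y : (y \in lker (linfun kl)) <-> forall z, killing y z = 0.
  rewrite memv_ker linfun_linear //; split=> [/eqP /rowP y0 z|y0]; last first.
    by apply/eqP/rowP => i; rewrite !mxE.
  rewrite -(phiK z) (row_sum_delta (phi z)) !linear_sum big1 // => i _.
  by rewrite !linearZ /=; have := y0 i; rewrite !mxE => ->; rewrite scaler0.
have [y z /klP z0||kfull] := g_simple.2 (lker (linfun kl)).
- by apply/klP => w; rewrite lieC killingC linearN /= killingC killing_inv z0 oppr0.
- by move=> k0; apply/eqP; rewrite -memv0 -k0; apply/klP.
have nil h : ad h ^+ n.+1 = 0.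
  apply: killing0_nilpotent (simple_derived g_simple) => y z.
  by move: z; apply/klP; rewrite kfull memvf.
have gH v : v \in H.
  apply: engel => h _; exists n.+1.
  by rewrite subr0 /pact rmorphXn /= horner_mx_X nil mulmx0 linear0.
have g0 : lower K = {:g}%VS.
  have -> : H = {:g}%VS by apply/vspaceP => v; rewrite gH memvf.
  by elim: K => //= k ->; exact: simple_derived.
have [[y [z /eqP yz]] _] := g_simple; case: yz.
by apply/eqP; rewrite -memv0 -H_nil g0 memvf.
Qed.

(** Pairing with [k] sees only the joint null component of a vector, because [(ad h)^K] kills [k];
    and that component lies in H. *)
Lemma killing_nondegenerate_sub k :
  k \in H -> (forall h, h \in H -> killing k h = 0) -> k = 0.
Proof.
move=> kH k0; apply: killing_nondegenerate => v.
have [hc /mapP[h /lower_basis_sub hH ->] //|_ w /mapP[h /lower_basis_sub hH ->]|u [uL <-]] :=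
  @fitting_seq [seq (h, 0) | h <- lower_basis] K k v.
  by rewrite pact_lie_skew oppr0 nilpotent_pact // killingC linear0 mulr0.
apply/k0/engel => h hL; exact: (uL _ (map_f _ hL)).
Qed.

Lemma root_nonisotropic x t (a : g -> C) :
  x != 0 -> (forall h, h \in H -> lie h x = a h *: x) ->
  t \in H -> (forall h, h \in H -> killing t h = a h) ->
  (exists2 h, h \in H & a h != 0) -> a t != 0.
Proof.
move=> x0 xa tH ta [h0 h0H ah0]; apply/eqP => at0; move/eqP: x0; apply.
apply: killing_nondegenerate => w; apply/eqP; apply: contraT => xw.
(* Exponent 1 suffices, as [x] is a genuine eigenvector: the images of ad h + a(h) are orthogonal to
   it. *)
have [hc /mapP[h /lower_basis_sub hH ->] //|_ u /mapP[h /lower_basis_sub hH ->]|y [yL xy]] :=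
  @fitting_seq [seq (h, - a h) | h <- lower_basis] 1 x w.
  rewrite pact_lie_skew opprK !expr1 pact_XsubC xa // subrr.
  by rewrite killingC linear0 mulr0.
move: xw; rewrite -{}xy; set c := killing x y => c0.
have zH : lie x y \in H.
  apply: engel => h hL; have hH := lower_basis_sub hL.
  have [k yk] := yL _ (map_f _ hL); exists (1 + k)%N.
  have xk : pact h (('X - (a h)%:P) ^+ 1) x = 0.
    by rewrite expr1 pact_XsubC xa // subrr.
  by have := pact_lie xk yk; rewrite subrr.
have zk h : h \in H -> killing (lie x y) h = c * a h.
  move=> hH; rewrite killingC -killing_inv xa // killingC linearZ /= mulrC.
  by rewrite killingC.
have az : a (lie x y) = 0 by rewrite -ta // killingC zk // at0 mulr0.
have zx : lie (lie x y) x = 0 by rewrite xa // az scale0r.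
(* The common eigenvector [x] forces a([h, h']) = 0, so [z, h] is orthogonal to H for z = [x, y]. *)
have zcent h : h \in H -> lie (lie x y) h = 0.
  move=> hH; apply: killing_nondegenerate_sub => [|h' h'H]; first exact: H_lie.
  rewrite killing_inv zk ?H_lie //.
  suff /eqP : a (lie h h') *: x = 0.
    by rewrite scaler_eq0 => /orP[/eqP ->|/eqP x0]; rewrite ?mulr0 // /c x0 killingC linear0 mul0r.
  rewrite -xa ?H_lie // lie_lie (xa h) // (xa h') // ![lie _ (_ *: _)]linearZ /= !xa //.
  by rewrite !scalerA mulrC subrr.
have adz0 : ad (lie y x) ^+ n.+1 = 0.
  rewrite ad_lie; apply: comm_commutator_nilpotent; rewrite -ad_lie.
  by apply/eqP; rewrite -subr_eq0 -ad_lie (lieC y) -scaleN1r lieZl zx scaler0 linear0.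
(* A nilpotent matrix times one commuting with it is nilpotent, hence of trace 0; yet this pairing
   is -c a(h0). *)
have : killing (lie y x) h0 = 0.
  rewrite killing_ad; apply: (@nilpotent_mxtrace _ _ _ n.+1).
  rewrite mulmxE exprMn_comm ?adz0 ?mul0r //.
  apply/eqP; rewrite -subr_eq0 -ad_lie (lieC y) linearN /= lieC zcent //.
  by rewrite oppr0 oppr0 linear0.
rewrite lieC killingC linearN /= killingC zk // => /eqP.
by rewrite oppr_eq0 mulf_eq0 (negPf c0) (negPf ah0).
Qed.
End NilpotentSubalgebra.
End Coordinates.

Lemma dual_killing_root_neq0 (C : numClosedFieldType) (g : finLieAlgType C)
    (H : {vspace g}) (a : 'Hom(subvs_of H, C^o)) :
  simple_lie g -> cartan_subalgebra {:g} H -> root_system H a ->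
  dual_killing a a != 0.
Proof.
move=> gs [_ Hl [K Hn] Hs] [a0 [x x0 xa]].
have [|n [phi [psi [phiK psiK trE]]]] := @matrix_coordinates _ g; first by exists x.
have Hs' y : {in H, forall h, lie y h \in H} -> y \in H by apply: Hs; rewrite memvf.
have flat0 : lker (killing_flat H) == 0%VS.
  rewrite -subv0; apply/subvP => h; rewrite memv_ker memv0 => /eqP h0.
  apply/eqP/val_inj; rewrite linear0.
  apply: (killing_nondegenerate_sub phiK psiK trE Hl Hn Hs' gs) => [|h' h'H].
    exact: subvsP.
  by rewrite -(vsprojK h'H) -killing_flatE h0 zero_lfunE.
(* Injectivity and equality of dimensions make [killing_flat] bijective, so its inverse yields a
   true representative [t] of [a], and (a, a) = a(t). *)
have flatT : limg (killing_flat H) = fullv.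
  apply/eqP; rewrite eqEdim subvf limg_dim_eq; last first.
    by rewrite (eqP flat0) capv0.
  by rewrite !dimvf /dim /= muln1.
set t := (killing_flat H)^-1%VF a.
have ta h : killing (vsval t) (vsval h) = a h.
  by rewrite -killing_flatE limg_lfunVK // flatT memvf.
rewrite /dual_killing -/t ta.
have [h ah] : exists h, a h != 0.
  apply: contrapT => /forallNP a1; case/eqP: a0; apply/funext => h.
  by apply/eqP/negPn/negP/a1.
have := @root_nonisotropic _ _ _ _ _ phiK psiK trE H K Hl Hn Hs' gs x (vsval t)
  (fun h => a (vsproj H h)) x0.
rewrite vsvalK => r; apply: r.
- by move=> k kH; rewrite -xa vsprojK.
- exact: subvsP.
- by move=> k kH; rewrite -ta vsprojK.
- by exists (vsval h); rewrite ?subvsP ?vsvalK.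
Qed.

(** * The toroidal Lie algebra *)

Local Open Scope classical_set_scope.

Section ToroidalAction.
Variables (F : numFieldType) (g : finLieAlgType F).

Lemma weight0 (c : 'rV[F]_2) : weight c 0 = 0.
Proof. by rewrite /weight big1 // => j _; rewrite mxE mulr0. Qed.

Lemma weight2 (c : 'rV[F]_2) r : weight c r = c 0 0 * (r 0 0)%:~R + c 0 1 * (r 0 1)%:~R.
Proof.
rewrite /weight !big_ord_recl big_ord0 addr0.
by congr (c 0 _ * (r 0 _)%:~R + c 0 _ * (r 0 _)%:~R); apply: val_inj.
Qed.

Lemma deriv_mono0 (V : lmodType F) (c : 'rV[F]_2) (x : V) : Defs.deriv c (mono 0 x) = 0.
Proof. by rewrite deriv_mono weight0 scale0r linear0. Qed.

Lemma coeff_deriv (V : lmodType F) (c : 'rV[F]_2) (u : loop V) r :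
  Defs.deriv c u r = weight c r *: u r.
Proof.
apply/eqP; rewrite -subr_eq0; apply/eqP; move: u; apply: loop_ext0 => [|s x].
  apply: linD; first by move=> a u v; rewrite deriv_linear.
  by apply: linN; apply: linZ => a u v.
rewrite deriv_mono !monoE; case: eqP => [->|_]; first by rewrite subrr.
by rewrite scaler0 subrr.
Qed.

Lemma coeff_loop_lie0 (x : g) (u : loop g) r : loop_lie (mono 0 x) u r = lie x (u r).
Proof.
apply/eqP; rewrite -subr_eq0; apply/eqP; move: u; apply: loop_ext0 => [|s y].
  apply: linD; first by move=> a u v; rewrite loop_lie_linearr.
  by apply: linN; apply: lin_comp; [exact: lie_linearr | move=> a u v].
rewrite loop_lie_mono add0r !monoE; case: eqP => _; first by rewrite subrr.
by rewrite linear0 subrr.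
Qed.

(** The cocycle differentiates its first argument, here constant in t. *)
Lemma cocycle_mono0 (x : g) (u : loop g) : cocycle (mono 0 x) u = 0.
Proof.
move: u; apply: loop_ext0 => [|s y]; first exact: cocycle_linearr.
rewrite cocycle_mono; have -> : intdeg F 0 = 0 by apply/rowP => j; rewrite !mxE.
by rewrite scaler0 !linear0.
Qed.

Lemma loop_neq0 (V : lmodType F) (u : loop V) : u != 0 -> exists r, u r != 0.
Proof.
move=> u0; apply: contrapT => /forallNP ur; case/eqP: u0; apply: loopP => r.
by apply/eqP/negPn/negP/ur.
Qed.

Lemma toroidal_lie_degree0 (x : g) (s c : 'rV[F]_2) u w e :
  toroidal_lie (mono 0 x, kclass (mono 0 s), c) (u, w, e) =
  (loop_lie (mono 0 x) u + Defs.deriv c u, kderiv c w, 0).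
Proof.
rewrite /= deriv_mono0 cocycle_mono0 kderiv_class deriv_mono0.
by rewrite [kclass 0]linear0 !subr0 add0r.
Qed.
End ToroidalAction.

(** * Roots of the untwisted algebra *)

Section Untwisted.
Variables (R : realType) (g : finLieAlgType R[i]).

Lemma epsilon1 : epsilon R 1 = 1.
Proof. by rewrite /epsilon divr1 mulr_natl cos2pi sin2pi. Qed.

Lemma graded_id r : graded (id_twist g) r = {:g}%VS.
Proof.
rewrite /graded big1 // => j _; apply/vspaceP => x; rewrite memvf.
by rewrite memv_ker /= epsilon1 exp1rz scale1r subrr zero_lfunE eqxx.
Qed.

(** Both orders are 1, so every degree is allowed in [kahler_sigma] and every graded piece is g. *)
Lemma id_twisted_toroidal x : twisted_toroidal (id_twist g) x.
Proof.
split=> [r|]; first by rewrite graded_id memvf.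
exists (krepr x.1.2); last exact: kreprK.
by move=> r _; exists r => j; rewrite mul1r.
Qed.

Variable H : {vspace g}.
Local Notation dualH := 'Hom(subvs_of H, (R[i])^o).

Lemma extend0E (a : dualH) h : extend0 a h = a h.1.1.
Proof. by rewrite /extend0 linfun_linear // => c x y; rewrite linearP. Qed.

Lemma deltaE j (h : cartan H) : delta H j h = h.1.2 0 j.
Proof. by rewrite /delta linfun_linear // => c x y; rewrite !mxE. Qed.

Lemma spaceV_E (a : dualH) c0 c1 h :
  (extend0 a + c0 *: delta H 0 + c1 *: delta H 1) h =
  a h.1.1 + c0 * h.1.2 0 0 + c1 * h.1.2 0 1.
Proof. by rewrite !add_lfunE !scale_lfunE extend0E !deltaE. Qed.

Lemma restrictH_spaceV (a : dualH) c0 c1 :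
  restrictH (extend0 a + c0 *: delta H 0 + c1 *: delta H 1) = a.
Proof.
apply/lfunP => h; rewrite /restrictH linfun_linear => [|c x y].
  by rewrite spaceV_E /= !mxE !mulr0 !addr0.
by rewrite !spaceV_E /= !mxE !mulr0 !addr0 linearP.
Qed.

Lemma lie_cartan_incl (h : cartan H) u w e : lie (cartan_incl h) (u, w, e) =
  (loop_lie (mono 0 (vsval h.1.1)) u + Defs.deriv h.1.2 u, kderiv h.1.2 w, 0) :> toroidal g.
Proof.
exact: toroidal_lie_degree0.
Qed.
End Untwisted.


Theorem mainTheorem2 (R : realType) (g : finLieAlgType R[i]) (X : dynkin_type)
    (H : {vspace g}) :
  dynkin_valid X -> simple_lie g -> has_type g X ->
  cartan_subalgebra (graded (id_twist g) 0) H ->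
  nonisotropic_roots (id_twist g) H =
  [set b | exists (a : 'Hom(subvs_of H, (R[i])^o)) (m n : int),
     root_system H a /\
     b = extend0 a + m%:~R *: delta H 0 + n%:~R *: delta H 1].
Proof.
move=> _ gs _; rewrite graded_id => Hc; apply/seteqP; split=> b /=.
  case=> -[a [c0 [c1 ->]]]; rewrite /formV restrictH_spaceV => aa [[[u w] e] x0 [_ xb]].
  (* Nonisotropy enters here: it forces [a] to be nonzero. *)
  have [k ak] : exists k, a k != 0.
    apply: contrapT => /forallNP a1; case/eqP: aa.
    have -> : a = 0.
      by apply/lfunP => k; rewrite zero_lfunE; apply/eqP/negPn/negP/a1.
    by rewrite /dual_killing !linear0.
  (* An element of H kills the central and derivation components, while the weight multiplies them
     by a(k), which is nonzero; both vanish. *)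
  have := xb ((k, 0), 0); rewrite lie_cartan_incl spaceV_E /= !mxE !mulr0 !addr0.
  move=> [_ w0 e0].
  have {}e0 : e = 0.
    by apply/eqP; move/esym/eqP: e0; rewrite scaler_eq0 (negPf ak).
  have {}w0 : w = 0.
    apply/eqP; move/esym/eqP: w0.
    by rewrite (linear_at0 (kderiv_linearc w)) scaler_eq0 (negPf ak).
  have [r ur] : exists r, u r != 0.
    by apply: loop_neq0; apply: contraNneq x0 => u0; rewrite u0 w0 e0.
  have ub k' (c : 'rV_2) : lie (vsval k') (u r) + weight c r *: u r =
      (a k' + c0 * c 0 0 + c1 * c 0 1) *: u r.
    have := congr1 (fun y : toroidal g => y.1.1 r) (xb ((k', c), 0)).
    by rewrite lie_cartan_incl spaceV_E /= coeffD coeff_loop_lie0 coeff_deriv coeffZ.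
  (* Setting c = 0 isolates the action of H; setting k' = 0 below isolates the degree. *)
  have uh k' : lie (vsval k') (u r) = a k' *: u r.
    by have := ub k' 0; rewrite weight2 !mxE !mul0r !mulr0 !addr0 scale0r addr0.
  have uc (c : 'rV_2) : weight c r = c0 * c 0 0 + c1 * c 0 1.
    have := ub 0 c; rewrite linear0 linear0 lie0l !add0r => /eqP.
    by rewrite -subr_eq0 -scalerBl scaler_eq0 (negPf ur) orbF subr_eq0 => /eqP.
  exists a, (r 0 0), (r 0 1); split.
    split; last by exists (u r).
    by apply: contraNneq ak => ->.
  have c0E : (r 0 0)%:~R = c0.
    by have := uc (delta_mx 0 0); rewrite weight2 !mxE !eqxx /= !mul1r !mul0r mulr1 mulr0 !addr0.
  have c1E : (r 0 1)%:~R = c1.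
    by have := uc (delta_mx 0 1); rewrite weight2 !mxE !eqxx /= !mul1r !mul0r mulr1 mulr0 !add0r.
  by rewrite c0E c1E.
case=> a [m [n [ar ->]]]; split.
- by exists a, m%:~R, n%:~R.
- by rewrite /formV restrictH_spaceV; exact: dual_killing_root_neq0.
have [_ [x x0 xa]] := ar.
(* Conversely, x (x) t_0^m t_1^n is a weight vector for any root vector x. *)
pose r : 'rV[int]_2 := \row_j (if j == 0 then m else n).
exists ((mono r x, 0, 0) : toroidal g).
  apply: contraNneq x0 => /(congr1 (fun y : toroidal g => y.1.1 r)) /=.
  by rewrite monoE eqxx coeff0 => ->.
split; first exact: id_twisted_toroidal.
move=> h; rewrite lie_cartan_incl spaceV_E.
rewrite (linear_at0 (kderiv_linear _)); congr (_, _, _); rewrite ?scaler0 //.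
rewrite loop_lie_mono add0r deriv_mono xa weight2 !mxE /=.
by rewrite -linearD -linearZ -scalerDl /= addrA (mulrC m%:~R) (mulrC n%:~R).
Qed.
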